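(* For any strict partition $\lambda=(\lambda_1,\dots,\lambda_l)$, $$(L_{-1})^\perp Q_\lambda=-\frac14\sum_{\substack{i,j=1\\ i\ne j}}^{l(\lambda)}Q_{\lambda-\epsilon_i-\epsilon_j}+\sum_{i=1}^{l(\lambda)}\frac{2\lambda_i-3}4\,Q_{\lambda-2\epsilon_i}-\frac1\hbar\Big(\sum_{i=1}^{l(\lambda)}Q_{\lambda+\epsilon_i}+\frac12Q_{(\lambda,1)}\Big),$$ and $$\begin{aligned}(L_2)^\perp Q_\lambda={}&\sum_{\substack{i,j=1\\ i\ne j}}^{l(\lambda)}Q_{\lambda+3\epsilon_i+\epsilon_j}+\sum_{i=1}^{l(\lambda)}\frac{\lambda_i+4}2\,Q_{\lambda+4\epsilon_i}+\frac12\sum_{i=1}^{l(\lambda)}Q_{(\lambda+3\epsilon_i,1)}+\frac12\sum_{i=1}^{l(\lambda)}Q_{(\lambda+\epsilon_i,3)}\\&-\frac12\sum_{i=1}^{l(\lambda)}Q_{(\lambda+\epsilon_i,2,1)}+Q_{(\lambda,4)}-\frac12Q_{(\lambda,3,1)}-\frac1\hbar\Big(\sum_{i=1}^{l(\lambda)}Q_{\lambda+7\epsilon_i}+\frac12\sum_{r=0}^3(-1)^rQ_{(\lambda,7-r,r)}\Big).\end{aligned}$$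
   Context: Variables $\mathbf t=(t_1,t_3,t_5,\dots)$; $\hbar$ is a formal parameter (treated as a scalar). The operators are $$L_{-1}=\frac14t_1t_1+\frac12\sum_{k\ge1,\,k\text{ odd}}kt_k\frac{\partial}{\partial t_{k-2}}-\frac1{2\hbar}\frac{\partial}{\partial t_1},\qquad L_2=\frac12\sum_{k\ge1,\,k\text{ odd}}kt_k\frac{\partial}{\partial t_{k+4}}+\frac12\frac{\partial^2}{\partial t_1\partial t_3}-\frac1{2\hbar}\frac{\partial}{\partial t_7},$$ where $\partial/\partial t_{-1}$ is interpreted as $0$. Partitions: a partition of length $l(\lambda)=l$ is a finite sequence $\lambda=(\lambda_1,\dots,\lambda_l)$ of non-negative integers (in any order). It is strict if $\lambda_1>\cdots>\lambda_l>0$ (the empty partition $\emptyset$ counts as strict; $DP$ is the set of strict partitions), positive if all parts are positive, and weakly positive if at most one part is $0$. $\epsilon_i$ is the $i$-th standard basis vector, so $\lambda+a\epsilon_i$ changes $\lambda_i$ to $\lambda_i+a$; $(\lambda,a_1,\dots,a_s)$ means $\lambda$ with parts $a_1,\dots,a_s$ appended. Schur Q-polynomials (normalized as in Macdonald's book): define $q_k(\mathbf t)$ by $\sum_{k\ge0}q_k(\mathbf t)z^k=\exp\big(2\sum_{k\ge0}t_{2k+1}z^{2k+1}\big)$. For non-negative integers $(r,s)\ne(0,0)$ put $M_{(r,s)}=q_rq_s+2\sum_{i=1}^s(-1)^iq_{r+i}q_{s-i}$, and $M_{(0,0)}=0$. For a weakly positive partition $\lambda=(\lambda_1,\dots,\lambda_{2m})$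 of even length, $Q_\lambda(\mathbf t)=\mathrm{Pf}(M_{(\lambda_i,\lambda_j)})_{1\le i,j\le 2m}$; for positive $\lambda$ of odd length, $Q_\lambda=Q_{(\lambda,0)}$. The definition is extended to all partitions by: (i) switching adjacent parts $\lambda_i,\lambda_{i+1}$ not both $0$ changes the sign of $Q_\lambda$; (ii) $Q_{(\lambda,0)}=Q_\lambda$; (iii) $Q_\emptyset=1$. One negative part: if $\lambda\in\mathbb Z^l$ has exactly one negative part $\lambda_i<0$, and there is $j>i$ with $\lambda_j=-\lambda_i$ and $\lambda_k\ne-\lambda_i$ for all $k>i$, $k\ne j$, then $Q_\lambda:=(-1)^{j-i-1+\lambda_j}\,2\,Q_{\lambda^{\{i,j\}}}$, where $\lambda^{\{i,j\}}$ is $\lambda$ with the $i$-th and $j$-th parts deleted; otherwise $Q_\lambda:=0$. Adjoint: $\{Q_\lambda:\lambda\in DP\}$ is a basis of $\mathbb Q[t_1,t_3,\dots]$, and $\langle\cdot,\cdot\rangle$ is the inner product with $\langle Q_\lambda,Q_\mu\rangle=2^{l(\lambda)}\delta_{\lambda,\mu}$ for $\lambda,\mu\in DP$ (extended linearly over scalars involving $\hbar$). For an operator $f$, $f^\perp$ is its adjoint: $\langle f^\perp p_1,p_2\rangle=\langle p_1,fp_2\rangle$. *)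

(* Defs.v *)
From mathcomp Require Import all_boot all_order all_algebra.
From mathcomp Require Import all_fingroup finmap.
From mathcomp Require Import boolp classical_sets fsbigop.
From mathcomp.multinomials Require Import monalg.

Set Implicit Arguments.
Unset Strict Implicit.
Unset Printing Implicit Defensive.

Import GRing.Theory.

Local Open Scope ring_scope.

(* Polynomials over K in the countably many variables t_1, t_3, t_5, ...; the
   variable number i of the monoid algebra stands for t_{2i+1}. *)
Notation tpoly K := {malg K[{cmonom nat}]}.

Section Polynomials.
Variable K : fieldType.
Implicit Types (p : tpoly K) (i k : nat).

(* t_k, for odd k only. *)
Definition tvar k : tpoly K := << ucm k./2 >>.

Definition pderiv i p : tpoly K :=
  \sum_(m <- msupp p) << p@_m *+ m i *g divcm m (ucm i) >>.

(* The derivation d/dt_k for odd k, and 0 otherwise. In particular the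
   derivation of index 1 - 2 = 0 (truncated), standing for d/dt_{-1}, is 0. *)
Definition dt k p : tpoly K := if odd k then pderiv k./2 p else 0.

(* The coefficient of z^k in exp(2 * sum_i t_{2i+1} z^(2i+1)). As the exponent
   has no constant term, both it and the exponential series can be truncated
   after z^k, respectively after the k-th power. *)
Definition qk k : tpoly K :=
  let e : {poly tpoly K} := \sum_(i < k.+1 | odd i) (2%:R * tvar i) *: 'X^i in
  (\sum_(j < k.+1) ((j`!%:R^-1 : K)%:A : tpoly K) *: e ^+ j)`_k.

Definition qM (r s : nat) : tpoly K :=
  if (r == 0%N) && (s == 0%N) then 0
  else qk r * qk s
       + 2%:R * \sum_(1 <= i < s.+1) (-1) ^+ i * qk (r + i)%N * qk (s - i)%N.

Definition ord_dbl m (i : 'I_m) : 'I_m.*2 :=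
  Ordinal (etrans (ltn_double i m) (ltn_ord i)).
Definition ord_dblS m (i : 'I_m) : 'I_m.*2 :=
  Ordinal (etrans (ltn_Sdouble i m) (ltn_ord i)).

Definition pfaffian m (A : 'M[tpoly K]_(m.*2)) : tpoly K :=
  ((2 ^ m * m`!)%:R^-1 : K) *:
  \sum_(s : 'S_(m.*2))
     (-1) ^+ s * \prod_(i < m) A (s (ord_dbl i)) (s (ord_dblS i)).

(* Meaningful when the length of la is even. *)
Definition pfQ (la : seq nat) : tpoly K :=
  pfaffian (\matrix_(i < (size la)./2.*2, j < (size la)./2.*2)
              qM (nth 0%N la i) (nth 0%N la j)).

(* Number of pairs consisting of a zero part and a later nonzero part. *)
Fixpoint zinv (la : seq nat) : nat :=
  if la is a :: la' then
    ((if a == 0%N then count (fun x => x != 0%N) la' else 0) + zinv la')%N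
  else 0%N.

(* Q_la for a sequence of non-negative parts. If la is weakly positive of even
   length this is the Pfaffian. Otherwise the exchange rule brings all the zero
   parts to the end, which costs the sign (-1) ^ zinv la, and there they can be
   dropped; a positive mu of odd length has Q_mu = Q_(mu, 0). *)
Definition natQ (la : seq nat) : tpoly K :=
  if (count_mem 0%N la <= 1)%N && ~~ odd (size la) then pfQ la
  else let mu := [seq x <- la | x != 0%N] in
       (-1) ^+ zinv la * pfQ (if odd (size mu) then rcons mu 0%N else mu).

(* Q_la for integer parts; 0 by convention if several parts are negative. *)
Definition schurQ (la : seq int) : tpoly K :=
  match count (fun x => x < 0) la with
  | 0%N => natQ (map absz la)
  | 1%N =>
      let i := find (fun x => x < 0) la in
      let n := - nth 0 la i in
      let tl := drop i.+1 la in
      (* index n tl is j - i - 1, j being the position of the part equal to n *)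
      if count_mem n tl == 1%N then
        (-1) ^+ (index n tl + `|n|%N)%N * 2%:R
          * natQ (map absz (take i la ++ rem n tl))
      else 0
  | _ => 0
  end.

Definition strict (la : seq int) : bool :=
  sorted (fun x y => y < x) la && all (fun x => 0 < x) la.

Definition isQform (B : tpoly K -> tpoly K -> K) : Prop :=
  [/\ forall p, scalar (B p), forall p, scalar (B^~ p)
    & forall la mu, strict la -> strict mu ->
        B (schurQ la) (schurQ mu) = if la == mu then 2%:R ^+ size la else 0].

(* The inner product <.,.>: the Q_la, la strict, being a basis, there is exactly
   one such form when K has characteristic 0. *)
Definition Qform : tpoly K -> tpoly K -> K :=
  xget (fun _ _ => 0) [set B | isQform B].

Definition adjoint (f : tpoly K -> tpoly K) : tpoly K -> tpoly K :=
  xget (fun _ => 0)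
    [set g | forall p1 p2, Qform (g p1) p2 = Qform p1 (f p2)].

Variable hbar : K.

Definition Lm1 p : tpoly K :=
  4%:R^-1 *: (tvar 1 * tvar 1 * p)
  + 2%:R^-1 *: (\sum_(k \in [set k : nat | odd k]) k%:R * tvar k * dt (k - 2)%N p)
  - (2%:R * hbar)^-1 *: dt 1 p.

Definition L2 p : tpoly K :=
  2%:R^-1 *: (\sum_(k \in [set k : nat | odd k]) k%:R * tvar k * dt (k + 4)%N p)
  + 2%:R^-1 *: dt 1 (dt 3 p)
  - (2%:R * hbar)^-1 *: dt 7 p.

End Polynomials.

(* la + a epsilon_i, parts being numbered from 0. *)
Definition addp (la : seq int) (i : nat) (a : int) : seq int :=
  set_nth 0 la i (nth 0 la i + a).

(* The field of scalars Q(hbar). *)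
Definition Qh : fieldType := {fraction {poly rat}}.
Definition hbar : Qh := tofrac ('X : {poly rat}).

(* Main.v *)
From HB Require Import structures.
Require Import Defs.
From mathcomp Require Import all_boot all_order all_algebra.
From mathcomp Require Import all_fingroup finmap.
From mathcomp Require Import boolp classical_sets functions fsbigop.
From mathcomp.multinomials Require Import monalg.
From mathcomp Require Import ring zify.

(** Write [B_n] for the modes of the vertex operator
    [exp(2 sum_k t_k z^k) exp(- sum_k z^-k/k d/dt_k)], [k] odd.  They satisfy
    [[d/dt_k, B_n] = 2 B_(n-k)], [[t_k, B_n] = B_(n+k)/k] and
    [B_a B_b + B_b B_a = 2 (-1)^a delta_(a+b,0)], and by Wick's theorem the
    Pfaffian defining [Q_la] equals [B_(la_1) ... B_(la_l) 1].  The adjoint of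
    [B_n] is [(-1)^n B_(-n)], so the form [<t_k p, r> = <p, dr/dt_k>/(2k)] makes
    the strict [Q_la] orthogonal; hence it is the given inner product.  The
    adjoints of [L_(-1)] and [L_2] are then explicit differential operators, and
    commuting them through [B_(la_1) ... B_(la_l)] gives both formulas.

    Most operator identities hold because both sides obey the same commutation
    rules with all [t_k], and a polynomial is zero as soon as all its iterated
    derivatives vanish at the origin. *)

Set Implicit Arguments.
Unset Strict Implicit.
Unset Printing Implicit Defensive.

Import Order.TTheory GRing.Theory Num.Theory.

Local Open Scope ring_scope.

(** * Pfaffians *)

(** No exponential of differential operators is ever formed: [vop] is fixed by its values on 1 and
    by its commutation with the variables, so that every identity is an induction over products of
    variables or an instance of [family_eq0]. The obstacle is the constant term of [B_a B_b 1],
    which this recursion does not show. The inner product supplies it: by adjunction it is, up to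
    sign, the product of [B_(-a) 1] and [q_b], and Euler's identity [n q_n = 2 sum k t_k q_(n-k)]
    computes all products of two [q]. Hence the form is studied before the anticommutation
    relations, which rest on it. Its weight [1/(2k)] is the one that makes the rules for
    [[d/dt_k, B_n]] and [[t_k, B_n]] adjoint to each other; the sign [(-1)^n] comes from [k] being
    odd.

    The parts appended to [la] in the two formulas arise when [t_1], [3 t_3], [7 t_7] and
    [6 t_1 t_3] have been moved through all the vertex operators and reach 1, where they are
    rewritten through products [B_a B_b 1]. A negative part occurs only in [la - 2 epsilon_i] with
    [la_i = 1]; that part is then last, and both the convention and the vertex operators give 0. *)

Lemma ord_dbl_inj m : injective (@ord_dbl m).
Proof. by move=> i j /(congr1 val) /= e; apply: val_inj => /=; lia. Qed.

Lemma ord_dblS_inj m : injective (@ord_dblS m).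
Proof. by move=> i j /(congr1 val) /= e; apply: val_inj => /=; lia. Qed.

Lemma ord_dbl_neqS m (i j : 'I_m) : ord_dbl i != ord_dblS j.
Proof. by rewrite -val_eqE /=; lia. Qed.

Lemma ord_dblP m (x : 'I_m.*2) :
  exists i : 'I_m, x = ord_dbl i \/ x = ord_dblS i.
Proof.
have hx : (x./2 < m)%N by have := ltn_ord x; lia.
exists (Ordinal hx); have := odd_double_half x.
by case: (odd x) => e; [right | left]; apply: val_inj; rewrite /= -[LHS]e; lia.
Qed.

Lemma sum_dbl (V : nmodType) m (G : 'I_m.*2 -> V) :
  \sum_x G x = \sum_(i < m) (G (ord_dbl i) + G (ord_dblS i)).
Proof.
rewrite big_split /= (bigID (fun x : 'I_m.*2 => ~~ odd x)) /=.
have half (i : 'I_m.*2) : (i./2 < m)%N by have := ltn_ord i; lia.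
congr (_ + _).
  rewrite (reindex_onto (@ord_dbl m) (fun x => Ordinal (half x))) /=.
    by apply: eq_bigl => i; rewrite odd_double -val_eqE /= doubleK eqxx.
  by move=> x ox; apply: val_inj; rewrite /=; lia.
rewrite (reindex_onto (@ord_dblS m) (fun x => Ordinal (half x))) /=.
  apply: eq_bigl => i; rewrite negbK odd_double -val_eqE /=.
  by rewrite uphalf_double eqxx.
by move=> x ox; apply: val_inj; rewrite /=; lia.
Qed.

Lemma lift_perm_surj n (i j : 'I_n.+1) (s : 'S_n.+1) :
  s i = j -> exists t, s = lift_perm i j t.
Proof.
move=> sij; pose f k := odflt k (unlift j (s (lift i k))).
have fE k : lift j (f k) = s (lift i k).
  rewrite /f; case: unliftP => [k' -> //|e].
  have /perm_inj/eqP : s (lift i k) = s i by rewrite e.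
  by rewrite eq_sym (negPf (neq_lift _ _)).
have f_inj : injective f.
  move=> k l e; apply: (@lift_inj _ i); apply: (@perm_inj _ s).
  by rewrite -!fE e.
exists (perm f_inj); apply/permP => k.
case: (unliftP i k) => [k'|] ->; last by rewrite lift_perm_id.
by rewrite lift_perm_lift permE fE.
Qed.

Lemma lift_perm_inj n (i j : 'I_n.+1) : injective (lift_perm i j).
Proof.
move=> s t e; apply/permP => k; apply: (@lift_inj _ j).
by rewrite -!(lift_perm_lift i) e.
Qed.

Lemma sum_lift_perm (V : nmodType) n (i j : 'I_n.+1) (F : 'S_n.+1 -> V) :
  \sum_(s : 'S_n.+1 | s i == j) F s = \sum_(t : 'S_n) F (lift_perm i j t).
Proof.
rewrite (reindex_onto (lift_perm i j)
  (fun s => odflt 1%g [pick t | lift_perm i j t == s])) /=.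
  apply: eq_bigl => t; rewrite lift_perm_id eqxx.
  case: pickP => [t' /eqP/lift_perm_inj ->|/(_ t)]; first by rewrite eqxx.
  by rewrite eqxx.
move=> s /eqP/lift_perm_surj[t ->].
by case: pickP => [t' /eqP/lift_perm_inj ->|/(_ t)] //; rewrite eqxx.
Qed.

Section Pfaffian.
Variable R : comNzRingType.

Definition pfterm m (A : 'I_m.*2 -> 'I_m.*2 -> R) (s : 'S_m.*2) : R :=
  (-1) ^+ s * \prod_(i < m) A (s (ord_dbl i)) (s (ord_dblS i)).

(** This is [2 ^ m * m!] times the Pfaffian; leaving the division out makes it available over any
    commutative ring. *)
Definition pfsum m (A : 'I_m.*2 -> 'I_m.*2 -> R) : R := \sum_s pfterm A s.

Section Expansion.
Variables (m : nat) (A : 'I_m.+1.*2 -> 'I_m.+1.*2 -> R).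
Hypothesis Aanti : forall x y, x != y -> A x y = - A y x.

Let z := ord_dbl (ord0 : 'I_m.+1).
Let z' := ord_dblS (ord0 : 'I_m.+1).

(** Exchanging the two members of a pair costs one sign from the permutation and one from the
    antisymmetry of [A]. *)
Lemma pfterm_swap s : pfterm A (tperm z z' * s)%g = pfterm A s.
Proof.
rewrite /pfterm odd_permM odd_tperm ord_dbl_neqS signr_addb expr1 mulN1r.
rewrite !big_ord_recl /= !permM tpermL tpermR Aanti; last first.
  by rewrite (inj_eq perm_inj) eq_sym ord_dbl_neqS.
rewrite !mulNr mulrN opprK; congr (_ * (_ * _)); apply: eq_bigr => i _.
by rewrite !permM !tpermD.
Qed.

(** Exchanging two whole pairs is an even permutation and merely permutes the factors of the
    product. *)
Lemma pfterm_pairs k s :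
  pfterm A (tperm z (ord_dbl k) * tperm z' (ord_dblS k) * s)%g = pfterm A s.
Proof.
rewrite /pfterm !odd_permM !odd_tperm.
rewrite (inj_eq (@ord_dbl_inj _)) (inj_eq (@ord_dblS_inj _)) addbb.
congr (_ * _); rewrite [RHS](reindex_inj (@perm_inj _ (tperm ord0 k))) /=.
apply: eq_bigr => i _; rewrite !permM.
congr (A (s _) (s _)).
  by rewrite -(inj_tperm _ _ _ (@ord_dbl_inj _)) [LHS]tpermD // eq_sym ord_dbl_neqS.
rewrite [tperm z _ _]tpermD ?ord_dbl_neqS //.
by rewrite -(inj_tperm _ _ _ (@ord_dblS_inj _)).
Qed.

(** The symmetries [pfterm_swap] and [pfterm_pairs] act transitively on positions, so the place
    where the index 0 is taken does not affect the sum. *)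
Lemma pfterm_fiber x :
  \sum_(s : 'S_m.+1.*2 | s x == z) pfterm A s =
  \sum_(s : 'S_m.+1.*2 | s z == z) pfterm A s.
Proof.
have fiber (t : 'S_m.+1.*2) y y' : t y' = y ->
    (forall s, pfterm A (t * s)%g = pfterm A s) ->
    \sum_(s : 'S_m.+1.*2 | s y == z) pfterm A s =
    \sum_(s : 'S_m.+1.*2 | s y' == z) pfterm A s.
  move=> ty tA; rewrite [RHS](reindex_inj (mulgI t)).
  by apply: eq_big => [s|s _]; rewrite ?permM ?ty ?tA.
have [k [->|->]] := ord_dblP x.
  by apply: (fiber _ _ _ _ (pfterm_pairs k)); rewrite permM tpermL tpermD ?ord_dbl_neqS // eq_sym ord_dbl_neqS.
rewrite (fiber _ _ z' _ (pfterm_pairs k)).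
  by apply: (fiber _ _ _ _ pfterm_swap); rewrite tpermL.
by rewrite permM (@tpermD _ z (ord_dbl k) z') ?tpermL ?ord_dbl_neqS.
Qed.

(** Expansion along the first row. The factor counts the positions at which the index 0 may occur,
    all equivalent by [pfterm_fiber]; [j] is then the partner of 0, and the sign comes from removing
    both. *)
Lemma pfsum_expand : pfsum A = (m.+1.*2)%:R *
  \sum_(j < m.*2.+1) (-1) ^+ j * A ord0 (lift ord0 j) *
     pfsum (fun x y => A (lift ord0 (lift j x)) (lift ord0 (lift j y))).
Proof.
have zE : z = ord0 by apply: val_inj.
have z'E : z' = lift ord0 (ord0 : 'I_m.*2.+1) by apply: val_inj.
have -> : pfsum A = \sum_x \sum_(s : 'S_m.+1.*2 | s x == z) pfterm A s.
  rewrite (exchange_big_dep predT) //=; apply: eq_bigr => s _.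
  rewrite (big_pred1 (s^-1%g z)) // => x /=.
  by rewrite (can2_eq (permK s) (permKV s)).
under eq_bigr do rewrite pfterm_fiber.
rewrite sumr_const card_ord mulr_natl; congr (_ *+ _).
rewrite zE (@sum_lift_perm _ m.*2.+1) /=.
rewrite (partition_big (fun t : 'S_m.*2.+1 => t ord0) xpredT) //=.
apply: eq_bigr => j _; rewrite sum_lift_perm mulr_sumr; apply: eq_bigr => s _.
rewrite /pfterm !odd_lift_perm /= signr_addb signr_odd big_ord_recl /=.
rewrite -!/z -!/z' {1}zE z'E lift_perm_id lift_perm_lift lift_perm_id.
rewrite mulrACA; congr (_ * _ * (_ * _)).
apply: eq_bigr => i _.
have -> : ord_dbl (lift ord0 i) = lift ord0 (lift ord0 (ord_dbl i)).
  by apply: val_inj.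
have -> : ord_dblS (lift ord0 i) = lift ord0 (lift ord0 (ord_dblS i)).
  by apply: val_inj.
by rewrite !lift_perm_lift.
Qed.

End Expansion.
End Pfaffian.

(** * Vertex operators *)

(* [var i] stands for [t_(od i)]. *)
Notation od i := (i.*2.+1).
Notation oz i := (Posz i.*2.+1).

(* The ring [Q[t_1, t_3, ...]] with its derivations, its value [ev0] at the
   origin, the [q_k], the vertex operators [vop n], the inner product [form] and
   the derivations [dvn f] sending [var i] to [f i].  Keeping the ring abstract
   prevents conversion from unfolding the operations of [malg]. *)
Record bosonFock (K : fieldType) := BosonFock {
  carrier :> comAlgType K;
  fock_char0 : [pchar K] =i pred0;
  var : nat -> carrier;
  der : nat -> {linear carrier -> carrier};
  ev0 : {rmorphism carrier -> K};
  qf : nat -> carrier;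
  vop : int -> {linear carrier -> carrier};
  form : carrier -> carrier -> K;
  dvn : (nat -> carrier) -> {linear carrier -> carrier};
  ev0Z : forall c p, ev0 (c *: p) = c * ev0 p;
  ev0_var : forall i, ev0 (var i) = 0;
  der1 : forall i, der i 1 = 0;
  der_var : forall i j p,
    der i (var j * p) = (i == j)%:R * p + var j * der i p;
  carrier_ind : forall P : carrier -> Prop,
    P 1 -> (forall c p q, P p -> P q -> P (c *: p + q)) ->
    (forall i p, P p -> P (var i * p)) -> forall p, P p;
  carrier_eq0 : forall P : carrier -> Prop,
    (forall p, P p -> ev0 p = 0) -> (forall i p, P p -> P (der i p)) ->
    forall p, P p -> p = 0;
  ev0_qf : forall k, ev0 (qf k) = (k == 0%N)%:R;
  der_qf : forall i k,
    der i (qf k) = if (od i <= k)%N then 2%:R * qf (k - od i) else 0;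
  vop1 : forall n, vop n 1 = if n is Posz k then qf k else 0;
  vop_var : forall n i p,
    vop n (var i * p) = var i * vop n p - (od i)%:R^-1 *: vop (n + oz i) p;
  form_linr : forall p, scalar (form p);
  formC : forall p r, form p r = form r p;
  form1 : forall p, form 1 p = ev0 p;
  form_var : forall i p r,
    form (var i * p) r = (2 * od i)%N%:R^-1 * form p (der i r);
  dvn1 : forall f, dvn f 1 = 0;
  dvn_var : forall f i p, dvn f (var i * p) = f i * p + var i * dvn f p
}.

Section Commutation.
Variables (K : fieldType) (S : bosonFock K).
Implicit Types (p r : S) (i j : nat) (m n a b : int).

Local Notation X := (@var K S).
Local Notation d := (@der K S).
Local Notation e0 := (@ev0 K S).
Local Notation q := (@qf K S).
Local Notation B := (@vop K S).

Lemma natS_neq0 k : k.+1%:R != 0 :> K.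
Proof. by rewrite ((pcharf0P K).1 (fock_char0 S)). Qed.

Definition cst (c : K) : S := c%:A.

Lemma scE c p : c *: p = cst c * p.
Proof. by rewrite /cst mulr_algl. Qed.

Lemma cst_nat k : cst k%:R = k%:R.
Proof. by rewrite /cst scaler_nat. Qed.

Lemma cstN c : cst (- c) = - cst c.
Proof. by rewrite /cst scaleNr. Qed.

Lemma scale_sign k p : ((-1) ^+ k : K) *: p = (-1) ^+ k * p.
Proof.
rewrite -signr_odd -[in RHS]signr_odd.
by case: odd; rewrite ?expr1 ?scaleN1r ?mulN1r ?scale1r ?mul1r.
Qed.

Lemma linear_natl (f : {linear S -> S}) k p : f (k%:R * p) = k%:R * f p.
Proof. by rewrite !mulr_natl linearMn. Qed.

Lemma linear_sign (f : {linear S -> S}) k p : f ((-1) ^+ k * p) = (-1) ^+ k * f p.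
Proof. by rewrite -!scale_sign linearZ. Qed.

Lemma derM i p r : d i (p * r) = d i p * r + p * d i r.
Proof.
move: p; apply: carrier_ind => [|c p p' IH IH'|j p IH].
- by rewrite der1 mul0r !mul1r add0r.
- by rewrite mulrDl -!scalerAl !linearP /= IH IH' !scE; ring.
by rewrite -!mulrA !der_var IH; ring.
Qed.

(** The span of the family is closed under all derivations and consists of polynomials vanishing at
    the origin, so [carrier_eq0] applies to it. In the uses below, [D] is the difference of the two
    sides of an identity, indexed by all its integer parameters. *)
Lemma family_eq0 (I : Type) (D : I -> S) :
    (forall x, e0 (D x) = 0) ->
    (forall i x, exists s : seq (K * I),
        d i (D x) = \sum_(y <- s) y.1 *: D y.2) ->
  forall x, D x = 0.
Proof.
move=> D0 DD x.
apply: (@carrier_eq0 K S (fun p => exists s : seq (K * I), p = \sum_(y <- s) y.1 *: D y.2)).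
- move=> p [s ->]; rewrite raddf_sum big1 //= => y _.
  by rewrite ev0Z D0 mulr0.
- move=> i p [s ->] {p}; elim: s => [|[c b] s [s' IH]].
    by exists [::]; rewrite !big_nil linear0.
  have [s'' e] := DD i b.
  exists ([seq (c * y.1, y.2) | y <- s''] ++ s').
  rewrite big_cons linearP IH e big_cat big_map scaler_sumr /=.
  by congr (_ + _); apply: eq_bigr => y _; rewrite scalerA.
by exists [:: (1, x)]; rewrite big_seq1 scale1r.
Qed.

Lemma der_vop1 i n : d i (B n 1) = 2%:R * B (n - oz i) 1.
Proof.
rewrite !vop1; case: n => [k|k].
  rewrite der_qf; case: ltnP => [lt|le].
    by rewrite subzn.
  have : k%:Z - oz i < 0 by lia.
  by case: (_ - _) => [l|l] //; rewrite mulr0.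
have : Negz k - oz i < 0 by lia.
by case: (_ - _) => [l|l] //; rewrite linear0 mulr0.
Qed.

Lemma ev0_vop1 n : e0 (B n 1) = (n == 0)%:R.
Proof. by rewrite vop1; case: n => [k|k]; rewrite ?ev0_qf ?raddf0. Qed.

Lemma vop_lt0 n : n < 0 -> B n 1 = 0.
Proof. by rewrite vop1; case: n. Qed.

Lemma qf0 : q 0 = 1.
Proof.
apply/eqP; rewrite -subr_eq0; apply/eqP.
apply: (@carrier_eq0 K S (fun p => p = q 0 - 1 \/ p = 0)); last by left.
- by move=> p [->|->]; rewrite ?raddf0  // raddfB /= ev0_qf (rmorph1 e0) subrr.
- by move=> i p [->|->]; right; rewrite ?linear0 // linearB /= der_qf der1 subrr.
Qed.

Lemma vop0 : B 0 1 = 1.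
Proof. by rewrite vop1 -qf0. Qed.

Lemma var_vop n i p :
  X i * B n p = B n (X i * p) + (od i)%:R^-1 *: B (n + oz i) p.
Proof. by rewrite vop_var subrK. Qed.

Lemma der_vop i n p : d i (B n p) = B n (d i p) + 2%:R * B (n - oz i) p.
Proof.
move: p n; apply: carrier_ind => [|c p p' IH IH'|j p IH] n.
- by rewrite der1 linear0 add0r der_vop1.
- by rewrite !linearP /= IH IH' !scE; ring.
rewrite vop_var linearB linearZ /= !der_var !IH (linearD (B n)) /= !vop_var.
have -> : B n ((i == j)%:R * p) = (i == j)%:R * B n p.
  by case: eqP; rewrite ?mul1r // !mul0r linear0.
have -> : n + oz j - oz i = n - oz i + oz j by lia.
rewrite !scE; ring.
Qed.

End Commutation.

(** * Adjoints of the vertex operators, products of the [q_n], anticommutation relations *)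

Section Anticommutation.
Variables (K : fieldType) (S : bosonFock K).
Implicit Types (p r : S) (i j : nat) (m n a b : int).

Local Notation X := (@var K S).
Local Notation d := (@der K S).
Local Notation e0 := (@ev0 K S).
Local Notation q := (@qf K S).
Local Notation B := (@vop K S).
Local Notation form := (@form K S).

Lemma form_linl r : scalar (form^~ r).
Proof. by move=> c p p'; rewrite !(formC _ r) form_linr. Qed.
HB.instance Definition _ p :=
  GRing.isLinear.Build K S K *%R (form p) (form_linr p).

Lemma formZl c p r : form (c *: p) r = c * form p r.
Proof. by rewrite formC linearZ /= formC. Qed.
Lemma formDl p p' r : form (p + p') r = form p r + form (p') r.
Proof. by rewrite formC linearD /= !(formC r). Qed.
Lemma formBl p p' r : form (p - p') r = form p r - form (p') r.
Proof. by rewrite formC linearB /= !(formC r). Qed.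
Lemma formZr c p r : form p (c *: r) = c * form p r.
Proof. by rewrite linearZ. Qed.
Lemma formNr p r : form p (r *+ 2) = form p r *+ 2.
Proof. by rewrite linearMn. Qed.

Definition sg n : K := (-1) ^ n.

Lemma sg_odD n i : sg (n + oz i) = - sg n.
Proof.
rewrite /sg expfzDr ?oppr_eq0 ?oner_eq0 // -[_ ^ oz i]/(_ ^+ _).
by rewrite exprS -mul2n exprM sqrrN !expr1n mulr1 mulrN1.
Qed.
Lemma sg_odB n i : sg (n - oz i) = - sg n.
Proof. by rewrite -{2}(subrK (oz i) n) sg_odD opprK. Qed.
Lemma sgN n : sg (- n) = sg n.
Proof. by rewrite /sg -exprz_inv invrN1. Qed.
Lemma sg_sq n : sg n * sg n = 1.
Proof. by rewrite -{2}sgN /sg -expfzDr ?oppr_eq0 ?oner_eq0 // subrr. Qed.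

Lemma form_vop1 n r : form (B n 1) r = sg n * form 1 (B (- n) r).
Proof.
move: r n; apply: carrier_ind => [|c p p' IH IH'|i p IH] n.
- by rewrite formC !form1 !ev0_vop1 oppr_eq0; case: eqP => [->|]; rewrite ?mulr0 // mulr1.
- by rewrite !linearP /= IH IH'; ring.
rewrite formC form_var der_vop1 mulr_natl formNr formC IH sg_odB opprB.
rewrite vop_var linearB /= formZr [form 1 (X i * _)]formC form_var der1.
rewrite linear0 mulr0 sub0r (addrC (- n)) natrM invfM.
rewrite -mulr_natl; move: (natS_neq0 S i.*2) (natS_neq0 S 1).
by move: (od i)%:R => c c0 h2; field; rewrite c0 h2.
Qed.

(** Moving a variable across the form turns it into a derivation, and this exchanges the commutation
    rules of [B] with variables and with derivations. The index shifts by an odd number, which is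
    what changes [sg]. *)
Lemma form_vop n p r : form (B n p) r = sg n * form p (B (- n) r).
Proof.
move: p n r; apply: carrier_ind => [|c p p' IH IH'|i p IH] n r.
- exact: form_vop1.
- by rewrite linearP /= !formDl !formZl IH IH'; ring.
rewrite vop_var formBl formZl !form_var !IH der_vop linearD /= mulr_natl formNr.
rewrite sg_odD opprD natrM invfM -mulr_natl /=.
move: (natS_neq0 S i.*2) (natS_neq0 S 1).
by move: (od i)%:R => c c0 h2; field; rewrite c0 h2.
Qed.

Lemma der_natl i k p : d i (k%:R * p) = k%:R * d i p.
Proof. exact: linear_natl. Qed.
Lemma vop_natl n k p : B n (k%:R * p) = k%:R * B n p.
Proof. exact: linear_natl. Qed.

(** Euler's identity for [q_n], which is homogeneous of degree [n] when [t_k] has degree [k]. The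
    bound [N] only truncates the sum: beyond it the index [n - oz i] is negative and the term
    vanishes. *)
Lemma euler_qf (N : nat) n :
  n <= N%:Z ->
  B n 1 *~ n = 2%:R * \sum_(i < N) (od i)%:R * (X i * B (n - oz i) 1).
Proof.
(* With [N] fixed, derivations only lower [n], so the family restricted to [n <= N] and set to 0
   elsewhere is stable under them. *)
pose D n := if n <= N%:Z then
  B n 1 *~ n - 2%:R * \sum_(i < N) (od i)%:R * (X i * B (n - oz i) 1) else 0.
suff D0 : D n = 0 by move=> nN; apply/eqP; rewrite -subr_eq0; move: D0; rewrite /D nN => ->.
move: n; apply: family_eq0 => [n|j n].
  rewrite /D; case: ifP => _; last exact: raddf0.
  rewrite raddfB raddfMz /= ev0_vop1 rmorphM (raddf_sum e0) big1 ?mulr0 ?subr0.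
    by case: eqP => [->|] //; rewrite mul0rz.
  by move=> i _ /=; rewrite rmorphM (rmorphM e0) ev0_var mul0r mulr0.
rewrite /D; case: ifP => nN; last by exists [::]; rewrite big_nil linear0.
exists [:: (2, n - oz j)]; rewrite big_seq1 /=.
have -> : n - oz j <= N by lia.
rewrite linearB raddfMz /= der_vop1 der_natl linear_sum /=.
have -> : \sum_(i < N) d j ((od i)%:R * (X i * B (n - oz i) 1)) =
    (od j)%:R * B (n - oz j) 1 +
    2%:R * \sum_(i < N) (od i)%:R * (X i * B (n - oz j - oz i) 1).
  have -> : (od j)%:R * B (n - oz j) 1 =
      \sum_(i < N) (j == i)%:R * ((od i)%:R * B (n - oz i) 1).
    have [jN|Nj] := ltnP j N.
      rewrite (bigD1 (Ordinal jN)) //= eqxx mul1r big1 ?addr0 // => i.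
      by rewrite eq_sym -val_eqE /= => /negPf->; rewrite mul0r.
    rewrite vop_lt0 ?mulr0 ?big1 // => [i _|]; last by lia.
    by case: eqP => [e|]; rewrite ?mul0r //; have := ltn_ord i; lia.
  rewrite mulr_sumr -big_split; apply: eq_bigr => i _ /=.
  by rewrite der_natl der_var der_vop1 addrAC; ring.
rewrite scaler_nat mulrzBr -pmulrn -mulrzAr -[_ *+ 2]mulr_natl.
rewrite -[_ *+ od j]mulr_natl; ring.
Qed.

(** The squared norm of [B n 1], see [form_vop11]. *)
Definition qnorm n : nat := if n < 0 then 0 else if n == 0 then 1 else 2.

Lemma sum_qnorm (N : nat) n : n <= N%:Z ->
  (\sum_(i < N) qnorm (n - oz i) = if n is Posz k then k else 0)%N.
Proof.
elim: N n => [|N IH] n nN; first by rewrite big_ord0; case: n nN => // -[].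
rewrite big_ord_recl /=.
under eq_bigr => i _.
  have -> : n - oz (bump 0 i) = (n - 2) - oz i by rewrite /bump; lia.
  over.
rewrite IH; last by lia.
case: n nN => [[|[|n]]|n] nN //=; rewrite /qnorm /=; lia.
Qed.

(** Expanding [m q_m] by Euler's identity and moving each [t_k] across the form lowers both indices
    by [k] and cancels the weight [k]. By induction the result is twice a sum of norms, which
    [sum_qnorm] evaluates to [m]; dividing by [m] leaves 2. *)
Lemma form_vop11 m n : form (B m 1) (B n 1) = ((m == n) * qnorm m)%N%:R.
Proof.
have [N mN] : exists N : nat, m <= N%:Z by exists `|m|%N; lia.
elim: N m mN n => [|N IH] m mN n.
  have [m0|m0] : m < 0 \/ m = 0 by lia.
    by rewrite vop_lt0 // formC linear0 /qnorm m0 muln0.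
  by rewrite m0 vop0 form1 ev0_vop1 eq_sym muln1.
have [m0|m0] := leP m 0; first by apply: IH; lia.
have := @euler_qf N.+1 m mN.
have : qnorm m = 2%N.
  by rewrite /qnorm; have [-> ->] : (m < 0) = false /\ (m == 0) = false by lia.
case: m m0 mN => // m m0 mN ->.
rewrite -pmulrn => /(congr1 (fun p => form p (B n 1))).
rewrite formC linearMn /= mulr_natl [in RHS]formC linearMn linear_sum /=.
under eq_bigr => i _.
  rewrite mulr_natl linearMn /= formC form_var der_vop1 mulr_natl formNr.
  rewrite IH; last by lia.
  have -> : (m%:Z - oz i == n - oz i) = (m%:Z == n) by lia.
  have -> : (2 * od i)%:R^-1 * (((m%:Z == n) * qnorm (m%:Z - oz i))%:R *+ 2)
     *+ od i = ((m%:Z == n) * qnorm (m%:Z - oz i))%:R :> K.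
    rewrite mulrnAr -mulrnA -[_ *+ (2 * od i)]mulr_natr mulrAC mulVf ?mul1r //.
    exact: natS_neq0.
  over.
rewrite -natr_sum -big_distrr sum_qnorm //= formC => E.
have /mulIf : m%:R != 0 :> K by case: m m0 {mN E} => // m _; apply: natS_neq0.
apply; rewrite mulr_natr E -[LHS]mulr_natr -!natrM; congr (_%:R); lia.
Qed.

Lemma ev0_vop_vop m n : e0 (B m (B n 1)) = sg m * ((m + n == 0)%:R * (qnorm n)%:R).
Proof.
have := form_vop (- m) 1 (B n 1); rewrite form1 opprK sgN form_vop11.
move/(congr1 ( *%R (sg m))); rewrite mulrA sg_sq mul1r => <-.
rewrite natrM; congr (_ * _); have [e|ne] := eqVneq (m + n) 0.
  have -> : - m = n by lia.
  by rewrite eqxx.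
by case: eqP => [e|_]; [case/eqP: ne; lia | rewrite !mul0r].
Qed.

(** The scalar by which the anticommutator of [B a] and [B b] acts. *)
Definition car a b : K := if a + b == 0 then 2 * sg a else 0.

Lemma car_odB i a b : car (a - oz i) b + car a (b - oz i) = 0.
Proof.
rewrite /car addrA addrAC; case: eqP => _; last by rewrite addr0.
by rewrite sg_odB mulrN addNr.
Qed.

Lemma car_odD i a b : car (a + oz i) b + car a (b + oz i) = 0.
Proof.
rewrite /car addrA addrAC; case: eqP => _; last by rewrite addr0.
by rewrite sg_odD mulrN addNr.
Qed.

(** A derivation lowers [a] or [b] by an odd number, and the two resulting values of [car] cancel,
    so only constant terms matter. For [a + b = 0] these are [sg a] times [qnorm (- a) + qnorm a],
    which is always 2: one norm is 2 and the other 0, or both are 1. *)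
Lemma vop_anticomm1 a b : B a (B b 1) + B b (B a 1) = car a b *: 1.
Proof.
apply/eqP; rewrite -subr_eq0; apply/eqP.
pose D (x : int * int) := B x.1 (B x.2 1) + B x.2 (B x.1 1) - car x.1 x.2 *: 1.
rewrite -[LHS]/(D (a, b)); move: (a, b); apply: family_eq0 => [[{}a {}b]|i [{}a {}b]].
  rewrite /D /= raddfB raddfD /= ev0Z rmorph1 !ev0_vop_vop mulr1.
  rewrite /car (addrC b); case: eqP => ab; last by rewrite !(mul0r, mulr0) addr0 subrr.
  have -> : b = - a by lia.
  rewrite sgN !mul1r -mulrDr -natrD mulrC -mulrBl.
  suff -> : (qnorm (- a) + qnorm a)%N = 2 by rewrite subrr mul0r.
  by rewrite /qnorm oppr_lt0 oppr_eq0; case: ltgtP.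
exists [:: (2, (a - oz i, b)); (2, (a, b - oz i))].
rewrite !big_cons big_nil /D /= linearB linearD linearZ /= der1.
rewrite !der_vop !der1 !linear0 !add0r !vop_natl ?scaler0 ?subr0 ?addr0.
have /eqP := car_odB i a b; rewrite addr_eq0 => /eqP ->.
by rewrite !scE cst_nat cstN; ring.
Qed.

(** The anticommutator commutes with each variable: the two correction terms are anticommutators
    with one index raised by an odd number, and their scalars cancel by [car_odD]. So its value on 1
    determines it. *)
Lemma vop_anticomm a b p : B a (B b p) + B b (B a p) = car a b *: p.
Proof.
move: p a b; apply: carrier_ind => [|c p p' IH IH'|i p IH] a b.
- exact: vop_anticomm1.
- by rewrite !linearP /= addrACA -scalerDr IH IH' scalerA mulrC -scalerA.
rewrite !vop_var !linearB !linearZ /= !vop_var.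
transitivity (
    X i * (B a (B b p) + B b (B a p)) -
    (od i)%:R^-1 *: ((B (a + oz i) (B b p) + B b (B (a + oz i) p)) +
                     (B a (B (b + oz i) p) + B (b + oz i) (B a p)))).
  by rewrite !scalerDr !scE; ring.
by rewrite !IH -scalerDl car_odD scale0r scaler0 subr0 -scalerAr.
Qed.

Lemma vopC a b p : B a (B b p) = car a b *: p - B b (B a p).
Proof. by rewrite -vop_anticomm addrK. Qed.

Lemma vop_sq a p : a != 0 -> B a (B a p) = 0.
Proof.
move=> a0; have := vop_anticomm a a p; rewrite /car.
have -> : (a + a == 0) = false by lia.
rewrite scale0r -mulr2n -scaler_nat => /eqP.
by rewrite scaler_eq0 (negPf (natS_neq0 S 1)) => /eqP.
Qed.

Lemma car_nat0 (k l : nat) : (0 < k + l)%N -> car k l = 0.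
Proof. by rewrite /car => kl; case: eqP => //; lia. Qed.

(** This is the defining formula of the two-part [Q], proved for all integers [a] and [b] because
    derivations make the indices negative. They never raise [b], so one bound [N] serves the whole
    family. *)
Lemma vop_vop1_sum (N : nat) a b : b <= N%:Z ->
  B a (B b 1) = B a 1 * B b 1 +
    2%:R * \sum_(i < N) (-1) ^+ i.+1 * (B (a + i.+1%:Z) 1 * B (b - i.+1%:Z) 1).
Proof.
pose F (a b : int) : S := \sum_(i < N) (-1) ^+ i.+1 *
  (B (a + i.+1%:Z) 1 * B (b - i.+1%:Z) 1).
pose D (x : int * int) : S := if x.2 <= N%:Z then
  B x.1 (B x.2 1) - (B x.1 1 * B x.2 1 + 2%:R * F x.1 x.2) else 0.
suff : D (a, b) = 0 by rewrite /D /= => + bN; rewrite bN => /eqP; rewrite subr_eq0 => /eqP.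
move: (a, b); apply: family_eq0 => [[{}a {}b]|j [{}a {}b]]; rewrite /D /=.
  case: ifP => bN; last exact: raddf0.
  rewrite raddfB raddfD /= ev0_vop_vop !rmorphM /= !ev0_vop1 /F rmorph_nat raddf_sum /=.
  have -> : \sum_(i < N) e0 ((-1) ^+ i.+1 * (B (a + i.+1%:Z) 1 * B (b - i.+1%:Z) 1))
    = (0 < b)%R%:R * (a + b == 0)%:R * sg a.
    under eq_bigr do rewrite !rmorphM rmorphXn rmorphN1 /= !ev0_vop1 -natrM.
    case: b bN => [[|b]|b] bN.
    - by rewrite big1 ?mul0r // => i _; rewrite (_ : (_ - _ == 0) = false) ?muln0 ?mulr0 //; lia.
    - have bN' : (b < N)%N by lia.
      rewrite (bigD1 (Ordinal bN')) //= big1 ?addr0 => [|i]; last first.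
        rewrite -val_eqE /= => ib.
        by rewrite (_ : (b.+1%:Z - _ == 0) = false) ?muln0 ?mulr0 //; lia.
      rewrite subrr eqxx muln1 mul1r; case: eqP => [e|_]; last by rewrite mul0r mulr0.
      have -> : a = - b.+1%:Z by lia.
      by rewrite sgN mulr1 mul1r.
    by rewrite big1 ?mul0r // => i _; rewrite (_ : (_ - _ == 0) = false) ?muln0 ?mulr0 //; lia.
  rewrite /qnorm; have [b0|b0|->] := ltgtP b 0.
  - by rewrite !(mulr0, mul0r) addr0 subrr.
  - by rewrite !(mulr0, mul0r) add0r mul1r; ring.
  rewrite addr0 !mul0r mulr0 addr0 !mulr1.
  by case: eqP => [->|]; rewrite ?mulr0 ?subrr // /sg expr0z mul1r subrr.
case: ifP => bN; last by exists [::]; rewrite big_nil linear0.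
exists [:: (2, (a - oz j, b)); (2, (a, b - oz j))].
rewrite !big_cons big_nil /= bN.
have -> : b - oz j <= N%:Z by lia.
have dF : d j (F a b) = 2%:R * (F (a - oz j) b + F a (b - oz j)).
  rewrite /F raddf_sum -big_split mulr_sumr /=; apply: eq_bigr => i _.
  rewrite linear_sign derM !der_vop1.
  have -> : a + i.+1%:Z - oz j = a - oz j + i.+1%:Z by lia.
  have -> : b - i.+1%:Z - oz j = b - oz j - i.+1%:Z by lia.
  ring.
rewrite linearB linearD /= der_natl dF derM !der_vop !der1 !linear0 !add0r !vop_natl.
by rewrite !scE cst_nat; ring.
Qed.

Lemma vop_vop1 (k l : nat) :
  B k (B l 1) =
    q k * q l + 2%:R * \sum_(1 <= i < l.+1) (-1) ^+ i * q (k + i) * q (l - i).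
Proof.
rewrite (@vop_vop1_sum l) // !vop1 big_add1 big_mkord /=; congr (_ + _ * _).
apply: eq_bigr => i _; rewrite -mulrA; congr (_ * (_ * _)).
  by rewrite vop1 -PoszD.
by rewrite subzn ?vop1.
Qed.
End Anticommutation.

(** * Wick's theorem *)

Section Wick.
Variables (K : fieldType) (S : bosonFock K).
Implicit Types (p r : S) (i j : nat) (m n a b : int).

Local Notation X := (@var K S).
Local Notation d := (@der K S).
Local Notation e0 := (@ev0 K S).
Local Notation q := (@qf K S).
Local Notation B := (@vop K S).
Local Notation form := (@form K S).

Definition vops (la : seq int) p : S := foldr (fun a => B a) p la.

Lemma vops_cat la mu p : vops (la ++ mu) p = vops la (vops mu p).
Proof. exact: foldr_cat. Qed.

Lemma vops_linear la : linear (vops la).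
Proof. by move=> c p r; elim: la => //= a la ->; rewrite linearP. Qed.
HB.instance Definition _ la :=
  GRing.isLinear.Build K S S *:%R (vops la) (vops_linear la).

Definition delnth (T : Type) j (s : seq T) := take j s ++ drop j.+1 s.

Lemma nth_delnth (T : Type) (x0 : T) j s k :
  (j < size s)%N -> nth x0 (delnth j s) k = nth x0 s (bump j k).
Proof.
move=> js; rewrite nth_cat size_take js /bump; case: (ltnP k j) => kj.
  by rewrite nth_take // leqNgt kj.
by rewrite nth_drop addSn add1n subnKC.
Qed.

Lemma size_delnth (T : Type) j (s : seq T) :
  (j < size s)%N -> size (delnth j s) = (size s).-1.
Proof. by move=> js; rewrite size_cat size_take size_drop js; lia. Qed.

Lemma vop_vops a mu p :
  B a (vops mu p) =
    \sum_(j < size mu) ((-1) ^+ j * car K a mu`_j) *: vops (delnth j mu) p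
    + (-1) ^+ size mu *: vops mu (B a p).
Proof.
elim: mu => [|b mu IH] /=; first by rewrite big_ord0 add0r scale1r.
rewrite vopC IH big_ord_recl /= expr0 mul1r /delnth /= drop0.
rewrite linearD linear_sum linearZ /= opprD addrA exprS mulN1r scaleNr.
congr (_ + _ - _); rewrite -sumrN; apply: eq_bigr => j _.
by rewrite linearZ /= exprS mulN1r mulNr scaleNr.
Qed.

Lemma ev0_vopE a p : e0 (B a p) = sg K a * form (B (- a) 1) p.
Proof. by rewrite -form1 form_vop sgN opprK mulrA sg_sq mul1r. Qed.

(** Wick expansion of a constant term. For [a < 0] the operator [B a] kills 1, so only the
    contractions met on the way remain. For [a > 0] its adjoint kills 1, and both sides are 0. For
    [a = 0] the odd length is essential, as seen below. *)
Lemma ev0_vop_vops a mu : odd (size mu) ->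
  e0 (B a (vops mu 1)) =
    \sum_(j < size mu) (-1) ^+ j * e0 (B a (B mu`_j 1)) * e0 (vops (delnth j mu) 1).
Proof.
move=> oddmu; have [a0|a0|->] := ltgtP a 0.
- rewrite vop_vops vop_lt0 // linear0 scaler0 addr0 raddf_sum.
  apply: eq_bigr => j _ /=; rewrite ev0Z vopC (@vop_lt0 _ _ a) // linear0 subr0.
  by rewrite ev0Z rmorph1 mulr1.
- have B0 p : e0 (B a p) = 0.
    by rewrite ev0_vopE vop_lt0 ?oppr_lt0 // formC linear0 mulr0.
  by rewrite B0 big1 // => j _; rewrite B0 mulr0 mul0r.
have B0 p : e0 (B 0 p) = e0 p.
  by rewrite ev0_vopE oppr0 vop0 form1 /sg expr0z mul1r.
(* [B 0] fixes 1 and preserves constant terms. Passing it through an odd number of factors therefore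
   gives [x = s - x], hence [2 x = s]; the factor 2 is that of [car], since the constant term of
   [B 0 (B 0 1)] is 1. *)
have /(congr1 e0) := vop_vops 0 mu 1; rewrite raddfD B0 /= raddf_sum vop0.
rewrite -signr_odd oddmu expr1 scaleN1r raddfN /= => /eqP.
rewrite -subr_eq0 opprD opprK addrCA addrC subr_eq0 => /eqP E.
apply: (mulIf (natS_neq0 S 1)).
rewrite mulr_natr mulr2n E mulr_suml; apply: eq_bigr => j _.
rewrite ev0Z /= B0 ev0_vop1 /car add0r; case: eqP => _.
  by rewrite /sg expr0z -[true%:R]/(1 : K); ring.
by rewrite !(mulr0, mul0r).
Qed.

(** Indexed by positions instead of values and antisymmetric by decree: [B a (B b 1)] itself is not
    antisymmetric in [a] and [b] when [a + b = 0], a case that derivatives bring in. *)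
Definition wick (la : seq int) (x y : nat) : S :=
  if (x < y)%N then B la`_x (B la`_y 1)
  else if (y < x)%N then - B la`_y (B la`_x 1) else 0.

Lemma wick_anti la x y : x != y -> wick la x y = - wick la y x.
Proof. by rewrite /wick; case: ltngtP => // _ _; rewrite opprK. Qed.

(** [ev0_vop_vops] and [pfsum_expand] are the same recursion; the factor [2 (m + 1)] of the latter
    turns [2 ^ m * m!] into its successor. *)
Lemma ev0_vops_wick (m : nat) la : size la = m.*2 ->
  e0 (vops la 1) * (2 ^ m * m`!)%:R =
    pfsum (fun x y : 'I_m.*2 => e0 (wick la x y)).
Proof.
elim: m la => [|m IH] la.
  case: la => // _; rewrite mulr1 /= rmorph1 /pfsum.
  have un (s : 'S_0.*2) : s = 1%g by apply/permP => -[].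
  rewrite (big_pred1 1%g) => [|s]; last by rewrite /= (un s) eqxx.
  by rewrite /pfterm odd_perm1 big_ord0 mulr1.
case: la => // a mu [smu]; rewrite pfsum_expand => [|x y xy]; last first.
  by rewrite wick_anti ?raddfN // => /eqP/ord_inj/eqP; apply/negP.
have smu' : size mu = m.*2.+1 by [].
rewrite [vops _ _]/(B a (vops mu 1)) ev0_vop_vops ?smu' /= ?odd_double //.
rewrite expnS factS (_ : (2 * 2 ^ m * (m.+1 * m`!) = m.+1.*2 * (2 ^ m * m`!)))%N; last by nia.
rewrite natrM mulrCA; congr (_ * _); rewrite mulr_suml.
apply: eq_bigr => j _; have jmu : (j < size mu)%N by rewrite smu'.
rewrite -[LHS]mulrA IH ?size_delnth ?smu' //; congr (_ * _ * _).
apply: eq_bigr => s _; congr (_ * _); apply: eq_bigr => i _.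
congr (e0 _); rewrite /wick !nth_delnth //=.
rewrite /bump /= !add1n !ltnS.
(* Deleting an entry preserves the order of the others, so their contractions are unchanged. *)
have bl x y : (bump j x < bump j y)%N = (x < y)%N by rewrite /bump; lia.
by rewrite -!/(bump _ _) !bl.
Qed.

Lemma nth_addp (la : seq int) x c y :
  (addp la x c)`_y = la`_y + (if y == x then c else 0).
Proof. by rewrite /addp nth_set_nth /=; case: eqP => [->|]; rewrite ?addr0. Qed.

Lemma size_addp (la : seq int) x c :
  (x < size la)%N -> size (addp la x c) = size la.
Proof. by move=> xla; rewrite /addp size_set_nth; apply/maxn_idPr. Qed.

Lemma der_vops i la p :
  d i (vops la p) =
    2%:R * \sum_(j < size la) vops (addp la j (- oz i)) p + vops la (d i p).
Proof.
elim: la => [|a la IH] /=; first by rewrite big_ord0 mulr0 add0r.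
rewrite der_vop IH big_ord_recl linearD vop_natl linear_sum /=.
ring.
Qed.

Lemma var_vops i la p :
  X i * vops la p =
    (od i)%:R^-1 *: \sum_(j < size la) vops (addp la j (oz i)) p
    + vops la (X i * p).
Proof.
elim: la => [|a la IH] /=; first by rewrite big_ord0 scaler0 add0r.
rewrite var_vop IH big_ord_recl linearD linearZ linear_sum /=.
by rewrite !scE; ring.
Qed.

Lemma der_wick i la x y : x != y ->
  d i (wick la x y) =
    2%:R * (wick (addp la x (- oz i)) x y + wick (addp la y (- oz i)) x y).
Proof.
have E a b : d i (B a (B b 1)) =
    2%:R * (B (a - oz i) (B b 1) + B a (B (b - oz i) 1)).
  by rewrite der_vop der_vop1 vop_natl; ring.
move=> xy; rewrite /wick; case: ltngtP xy => // lt _; rewrite ?linearN E !nth_addp.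
  by rewrite !eqxx (gtn_eqF lt) (ltn_eqF lt) !addr0.
by rewrite !eqxx (gtn_eqF lt) (ltn_eqF lt) !addr0; ring.
Qed.

Lemma der_prod i (n : nat) (F : 'I_n -> S) :
  d i (\prod_(k < n) F k) = \sum_(k < n) d i (F k) * \prod_(l < n | l != k) F l.
Proof.
elim: n F => [|n IH] F; first by rewrite !big_ord0 der1.
rewrite big_ord_recl derM IH [RHS]big_ord_recl mulr_sumr; congr (_ * _ + _).
  by rewrite [RHS]big_mkcond big_ord_recl /= mul1r.
apply: eq_bigr => k _; rewrite [in RHS]big_mkcond big_ord_recl /= mulrCA.
congr (_ * (_ * _)); rewrite [LHS]big_mkcond; apply: eq_bigr => l _.
by rewrite (inj_eq lift_inj).
Qed.

(** A derivation acts on both sides in the same way: with factor 2, it lowers each part in turn. On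
    the Pfaffian this holds because every position occurs in exactly one factor of each term. The
    constant terms agree by [ev0_vops_wick]. *)
Lemma vops_pfaffian (m : nat) la : size la = m.*2 ->
  (2 ^ m * m`!)%:R * vops la 1 = pfsum (fun x y : 'I_m.*2 => wick la x y).
Proof.
pose D la : S := if size la == m.*2 then
  (2 ^ m * m`!)%:R * vops la 1 - pfsum (fun x y : 'I_m.*2 => wick la x y) else 0.
suff D0 : D la = 0.
  move=> sla; move: D0; rewrite /D sla eqxx => /eqP.
  by rewrite subr_eq0 => /eqP.
move: la; apply: family_eq0 => [la|i la].
  rewrite /D; case: eqP => [sla|_]; last exact: raddf0.
  rewrite raddfB /= rmorphM /= (rmorph_nat e0) mulrC (ev0_vops_wick sla) /pfsum raddf_sum.
  apply/eqP; rewrite subr_eq0; apply/eqP; apply: eq_bigr => s _ /=.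
  by rewrite /pfterm rmorphM rmorph_sign rmorph_prod.
rewrite {1}/D; case: eqP => [sla|_]; last by exists [::]; rewrite big_nil linear0.
exists [seq (2, addp la (x : 'I_m.*2) (- oz i)) | x <- enum 'I_m.*2].
rewrite big_map big_enum /=.
have DE x : D (addp la (x : 'I_m.*2) (- oz i)) = (2 ^ m * m`!)%:R * vops (addp la x (- oz i)) 1 -
   pfsum (fun y z : 'I_m.*2 => wick (addp la x (- oz i)) y z).
  by rewrite /D size_addp sla ?eqxx.
under eq_bigr do rewrite DE scalerBr.
rewrite sumrB linearB der_natl der_vops der1 linear0 addr0 sla; congr (_ - _).
  by rewrite -scaler_sumr -mulr_sumr scE cst_nat mulrCA.
rewrite /pfsum raddf_sum -scaler_sumr exchange_big scaler_sumr /=.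
apply: eq_bigr => s _; rewrite /pfterm -mulr_sumr.
rewrite linear_sign der_prod scalerAr; congr (_ * _).
rewrite (reindex_inj (@perm_inj _ s)) sum_dbl scaler_sumr.
apply: eq_bigr => k _.
rewrite der_wick; last by rewrite (inj_eq val_inj) (inj_eq perm_inj) ord_dbl_neqS.
(* Lowering the part at a position of the [k]-th pair leaves the factors of all other pairs
   untouched. *)
have W x : x = ord_dbl k \/ x = ord_dblS k ->
    \prod_(i0 < m) wick (addp la (s x) (- oz i)) (s (ord_dbl i0)) (s (ord_dblS i0)) =
    wick (addp la (s x) (- oz i)) (s (ord_dbl k)) (s (ord_dblS k)) *
    \prod_(l < m | l != k) wick la (s (ord_dbl l)) (s (ord_dblS l)).
  move=> xk; rewrite (bigD1 k) //=; congr (_ * _); apply: eq_bigr => l lk.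
  have [ne1 ne2] : s (ord_dbl l) != s x /\ s (ord_dblS l) != s x.
    rewrite !(inj_eq perm_inj) -!val_eqE /=.
    by move: lk; rewrite -val_eqE /=; case: xk => -> /=; lia.
  move: ne1 ne2; rewrite -!val_eqE /wick !nth_addp => /negPf-> /negPf->.
  by rewrite !addr0.
by rewrite !W; [rewrite scE cst_nat; ring | right | left].
Qed.
End Wick.

(* The definitions of Defs, in any algebra and for any sequence [q]. *)
Section GenericQ.
Variables (K : fieldType) (A : comAlgType K) (q : nat -> A).

Definition genM (r s : nat) : A :=
  if (r == 0%N) && (s == 0%N) then 0
  else q r * q s
       + 2%:R * \sum_(1 <= i < s.+1) (-1) ^+ i * q (r + i)%N * q (s - i)%N.

Definition genPf m (M : 'M[A]_(m.*2)) : A :=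
  ((2 ^ m * m`!)%:R^-1 : K) *:
  \sum_(s : 'S_(m.*2))
     (-1) ^+ s * \prod_(i < m) M (s (ord_dbl i)) (s (ord_dblS i)).

Definition genPfQ (la : seq nat) : A :=
  genPf (\matrix_(i < (size la)./2.*2, j < (size la)./2.*2)
              genM (nth 0%N la i) (nth 0%N la j)).

Definition genNatQ (la : seq nat) : A :=
  if (count_mem 0%N la <= 1)%N && ~~ odd (size la) then genPfQ la
  else let mu := [seq x <- la | x != 0%N] in
       (-1) ^+ zinv la * genPfQ (if odd (size mu) then rcons mu 0%N else mu).

Definition genQ (la : seq int) : A :=
  match count (fun x => x < 0) la with
  | 0%N => genNatQ (map absz la)
  | 1%N =>
      let i := find (fun x => x < 0) la in
      let n := - nth 0 la i in
      let tl := drop i.+1 la in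
      if count_mem n tl == 1%N then
        (-1) ^+ (index n tl + `|n|%N)%N * 2%:R
          * genNatQ (map absz (take i la ++ rem n tl))
      else 0
  | _ => 0
  end.

End GenericQ.

(** * Schur Q-polynomials as products of vertex operators *)

Section SchurQ.
Variables (K : fieldType) (S : bosonFock K).
Implicit Types (p r : S) (i j : nat) (m n a b : int).

Local Notation X := (@var K S).
Local Notation d := (@der K S).
Local Notation e0 := (@ev0 K S).
Local Notation q := (@qf K S).
Local Notation B := (@vop K S).
Lemma count_le1_nth (la : seq nat) c x y : (count_mem c la <= 1)%N ->
  (x < size la)%N -> (y < size la)%N -> nth 0%N la x = c -> nth 0%N la y = c ->
  x = y.
Proof.
elim: la x y => // z la IH [|x] [|y] //=.
- move=> cnt _ yla zc yc; move: cnt; rewrite zc eqxx ltnS leqn0 => /eqP/count_memPn.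
  by rewrite -yc mem_nth.
- move=> cnt xla _ xc zc; move: cnt; rewrite zc eqxx ltnS leqn0 => /eqP/count_memPn.
  by rewrite -xc mem_nth.
move=> cnt xla yla xc yc; congr _.+1; apply: IH => //.
by apply: leq_trans cnt; apply: leq_addl.
Qed.

(** Allowing one zero at most excludes the pair [(0, 0)], for which [genM] is 0 but [B 0 (B 0 1)] is
    1. For any other pair of non-negative parts [car] vanishes, so [genM] agrees with [wick] below
    the diagonal as well as above it. *)
Lemma genPfQ_vops (la : seq nat) :
  (count_mem 0%N la <= 1)%N -> ~~ odd (size la) ->
  genPfQ q la = vops (map Posz la) (1 : S).
Proof.
move=> cnt ev; set n := (size la)./2.
have sla : size (map Posz la) = n.*2.
  by rewrite size_map -[LHS]odd_double_half (negPf ev).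
have c0 : (2 ^ n * n`!)%:R != 0 :> K.
  have : (0 < 2 ^ n * n`!)%N by rewrite muln_gt0 expn_gt0 fact_gt0.
  by case: (_ * _)%N => // k _; apply: natS_neq0.
apply: (scalerI c0); rewrite [RHS]scE cst_nat (vops_pfaffian S sla).
rewrite /genPfQ /genPf -/n scalerA mulfV // scale1r.
apply: eq_bigr => s _; congr (_ * _); apply: eq_bigr => i _; rewrite mxE.
have ne : s (ord_dbl i) != s (ord_dblS i).
  by rewrite (inj_eq perm_inj) ord_dbl_neqS.
move: (s _) (s _) ne => y x; rewrite -val_eqE /= => ne.
have [xs ys] : (x < size la)%N /\ (y < size la)%N.
  by rewrite -(size_map Posz) sla !ltn_ord.
have gt0 : (0 < nth 0 la x + nth 0 la y)%N.
  rewrite lt0n addn_eq0; apply/negP => /andP[/eqP x0 /eqP y0].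
  by case/eqP: ne; apply: (count_le1_nth cnt).
rewrite /wick !(nth_map 0%N) // /genM.
have -> : (nth 0 la x == 0)%N && (nth 0 la y == 0)%N = false.
  by apply/negbTE; rewrite -addn_eq0 -lt0n.
rewrite -vop_vop1; case: ltngtP ne => // _ _.
by rewrite vopC car_nat0 // scale0r sub0r.
Qed.

(** [B 0] anticommutes with [B a] for positive [a] and fixes 1, so each zero part reaches the end at
    the cost of one sign per nonzero part crossed. *)
Lemma vops_zinv (la : seq nat) :
  vops (map Posz la) (1 : S) =
    (-1) ^+ zinv la * vops (map Posz [seq x <- la | x != 0%N]) (1 : S).
Proof.
elim: la => [|a la IH] /=; first by rewrite mul1r.
rewrite IH linear_sign; case: eqP => [->|_] /=; last by rewrite add0n.
rewrite exprD -size_filter [_ * (-1) ^+ zinv _]mulrC -mulrA; congr (_ * _).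
rewrite vop_vops big1 ?add0r => [|j _]; first by rewrite vop0 size_map scale_sign.
have jla : (j < size [seq x <- la | x != 0%N])%N by rewrite -(size_map Posz).
rewrite (nth_map 0%N) // car_nat0 ?mulr0 ?scale0r // add0n lt0n.
exact: (allP (filter_all _ la) _ (mem_nth _ jla)).
Qed.

Lemma genNatQ_vops (la : seq nat) : genNatQ q la = vops (map Posz la) (1 : S).
Proof.
rewrite /genNatQ; case: ifP => [/andP[c1 ev]|_]; first exact: genPfQ_vops.
rewrite vops_zinv /=; congr (_ * _); set mu := [seq x <- la | _].
have mu0 : count_mem 0%N mu = 0%N.
  by apply/count_memPn; rewrite mem_filter eqxx.
case: ifP => [o|/negbT ev]; last by rewrite genPfQ_vops ?mu0.
rewrite genPfQ_vops ?size_rcons ?negbK //; last first.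
  by rewrite -cats1 count_cat mu0.
by rewrite map_rcons -cats1 vops_cat /= vop0.
Qed.

Lemma genQ_ge0 (la : seq int) : all (fun x => 0 <= x) la ->
  genQ q la = vops la (1 : S).
Proof.
move=> ge0; rewrite /genQ.
have -> : count (fun x => x < 0) la = 0%N.
  apply/eqP; rewrite -leqn0 leqNgt -has_count -all_predC.
  by apply: sub_all ge0 => x /=; rewrite -leNgt.
rewrite genNatQ_vops -map_comp; congr (vops _ 1).
elim: la ge0 => //= x la IH /andP[x0 /IH->].
by rewrite gez0_abs.
Qed.

(** Both sides are 0: no part follows the negative one to pair with it, and [B a] kills 1. *)
Lemma genQ_rcons_lt0 (la : seq int) a : all (fun x => 0 <= x) la -> a < 0 ->
  genQ q (rcons la a) = vops (rcons la a) (1 : S).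
Proof.
move=> ge0 a0.
have nh : has (fun x => x < 0) la = false.
  apply/negbTE; rewrite -all_predC.
  by apply: sub_all ge0 => x /=; rewrite -leNgt.
rewrite -cats1 vops_cat /= vop_lt0 // linear0 /genQ count_cat find_cat nh /= a0.
have -> : count (fun x => x < 0) la = 0%N.
  by apply/eqP; rewrite -leqn0 leqNgt -has_count nh.
by rewrite addn0 drop_oversize // size_cat /= addn0 addn1.
Qed.

End SchurQ.

(** * The basis of strict partitions *)

Section Basis.
Variables (K : fieldType) (S : bosonFock K).
Implicit Types (p r : S) (i j : nat) (m n a b : int).

Local Notation X := (@var K S).
Local Notation d := (@der K S).
Local Notation e0 := (@ev0 K S).
Local Notation q := (@qf K S).
Local Notation B := (@vop K S).
Local Notation form := (@form K S).
Local Notation vone la := (vops la (1 : S)).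

Lemma strict_cons a (la : seq int) :
  strict (a :: la) = [&& 0 < a, all (fun x => x < a) la & strict la].
Proof.
rewrite /strict /= path_sortedE; last by move=> x y z /= yx zy; apply: lt_trans yx.
by case: (0 < a); rewrite /= ?andbF ?andbA.
Qed.

(** No part equals [a], so [B (- a)] passes through without contraction and kills 1. *)
Lemma vopN_vops a la : 0 < a -> all (fun x => x < a) la -> B (- a) (vone la) = 0.
Proof.
move=> a0 /allP laa; rewrite vop_vops vop_lt0 ?oppr_lt0 // linear0 scaler0 addr0.
rewrite big1 // => j _; rewrite /car.
have /= ja := laa _ (mem_nth 0 (ltn_ord j)); rewrite addrC subr_eq0 lt_eqF //.
by rewrite mulr0 scale0r.
Qed.

Lemma form_vop_gt a la p : 0 < a -> all (fun x => x < a) la ->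
  form (B a p) (vone la) = 0.
Proof. by move=> a0 laa; rewrite form_vop vopN_vops // linear0 mulr0. Qed.

(** If the first parts differ, the larger one, moved across the form, kills the other side. If both
    equal [a], the contraction of [B (- a)] with [B a] contributes the factor 2. *)
Lemma form_vops la mu : strict la -> strict mu ->
  form (vone la) (vone mu) = if la == mu then 2%:R ^+ size la else 0.
Proof.
elim: la mu => [|a la IH] [|b mu].
- by rewrite /= form1 rmorph1.
- rewrite strict_cons => _ /and3P[b0 _ _].
  by rewrite formC form_vop_gt.
- by rewrite strict_cons => /and3P[a0 _ _] _; rewrite form_vop_gt.
rewrite !strict_cons => /and3P[a0 laa sla] /and3P[b0 mub smu].
rewrite eqseq_cons /=; have [ab|ba|eab] /= := ltgtP a b.
- by rewrite formC (@form_vop_gt _ (a :: la)) //= ab; apply: sub_all laa => x /lt_trans; apply.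
- by rewrite (@form_vop_gt _ (b :: mu)) //= ba; apply: sub_all mub => x /lt_trans; apply.
rewrite -eab in mub *.
rewrite form_vop vopC (@vopN_vops _ mu) // linear0 subr0 formZr IH //.
rewrite /car addNr eqxx sgN; case: eqP => _; last by rewrite !mulr0.
by rewrite mulrA mulrCA sg_sq mulr1 exprS.
Qed.

Definition lin_closed (P : S -> Prop) :=
  P 0 /\ forall c p r, P p -> P r -> P (c *: p + r).

(** The span is encoded as membership in every subspace containing the generators, which spares
    coefficients and is directly an induction principle. *)
Definition in_span (A : seq int -> bool) p :=
  forall P, lin_closed P -> (forall la, A la -> P (vone la)) -> P p.

Lemma in_span_closed A : lin_closed (in_span A).
Proof.
split=> [P [] //|c p r pA rA P cP PA].
by apply: cP.2; [apply: pA | apply: rA].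
Qed.

Lemma in_spanZ A c p : in_span A p -> in_span A (c *: p).
Proof.
move=> pA; rewrite -[_ *: _]addr0; apply: (in_span_closed A).2 => //.
exact: (in_span_closed A).1.
Qed.

Lemma in_spanD A p r : in_span A p -> in_span A r -> in_span A (p + r).
Proof. by move=> pA rA; rewrite -[p]scale1r; apply: (in_span_closed A).2. Qed.

Lemma in_span_sum A I (s : seq I) (F : I -> S) :
  (forall x, in_span A (F x)) -> in_span A (\sum_(x <- s) F x).
Proof.
move=> FA; apply: big_ind => //; last exact: in_spanD.
exact: (in_span_closed A).1.
Qed.

Lemma in_span_linear (A A' : seq int -> bool) (f : {linear S -> S}) p :
  (forall la, A la -> in_span A' (f (vone la))) -> in_span A p -> in_span A' (f p).
Proof.
move=> fA pA; apply: (pA (fun p => in_span A' (f p))) => //.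
split=> [|c p' r p'A rA]; first by rewrite linear0; apply: (in_span_closed A').1.
by rewrite linearP; apply: (in_span_closed A').2.
Qed.

Definition strict_lt c la := strict la && all (fun x => x < c) la.

(** The bound [c] is what makes the induction work: after [B n] has been exchanged with a larger
    [B a], the terms obtained from the tail have all parts below [a], so prepending [a] keeps them
    strict. *)
Lemma span_vop_lt n c la :
  n < c -> strict_lt c la -> in_span (strict_lt c) (B n (vone la)).
Proof.
elim: la n c => [|a la IH] n c nc /=.
  move=> _; have [n0|n0|->] := ltgtP n 0.
  - by rewrite vop_lt0 //; apply: (in_span_closed _).1.
  - by move=> P _ PA; apply: (PA [:: n]); rewrite /strict_lt strict_cons /= n0 nc.
  by rewrite vop0 => P _ PA; apply: (PA [::]).
rewrite /strict_lt strict_cons /= => /andP[/and3P[a0 laa sla] /andP[ac lac]].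
have [na|an|->] := ltgtP n a; last 1 first.
- by rewrite vop_sq ?gt_eqF //; apply: (in_span_closed _).1.
- rewrite vopC; apply: in_spanD.
    by apply: in_spanZ => P _; apply; rewrite /strict_lt sla.
  rewrite -scaleN1r; apply: in_spanZ.
  apply: (@in_span_linear (strict_lt a)); last by apply: IH; rewrite /strict_lt ?sla.
  move=> mu /andP[smu mua] P _ PA; apply: (PA (a :: mu)).
  rewrite /strict_lt strict_cons /= a0 smu mua ac.
  by apply: sub_all mua => x /lt_trans; apply.
move=> P _ PA; apply: (PA (n :: a :: la)); rewrite /strict_lt !strict_cons /=.
rewrite a0 an laa sla ac lac nc (lt_trans a0 an) !andbT /=.
by apply: sub_all laa => x /lt_trans; apply.
Qed.

Lemma span_vop n p : in_span strict p -> in_span strict (B n p).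
Proof.
apply: in_span_linear => la sla.
have [c] : exists c : int, n < c /\ all (fun x => x < c) la.
  elim: (la) => [|a mu [c [nc muc]]]; first by exists (n + 1); split=> //; lia.
  have [ac|ca] := ltP a c; first by exists c; rewrite /= ac.
  exists (a + 1); split; first by lia.
  rewrite /=; apply/andP; split; first by lia.
  by apply: sub_all muc => x /= xc; lia.
case=> nc lac P cP PA; apply: (@span_vop_lt n c la) => //; first by rewrite /strict_lt sla.
by move=> mu /andP[smu _]; apply: PA.
Qed.

Lemma span_vops la p : in_span strict p -> in_span strict (vops la p).
Proof. by move=> sp; elim: la => //= a la; apply: span_vop. Qed.

Lemma span_1 : in_span strict 1.
Proof. by move=> P _ PA; apply: (PA [::]). Qed.

Lemma der_all_eq0 p : e0 p = 0 -> (forall j, d j p = 0) -> p = 0.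
Proof.
move=> ep dp; apply: (@carrier_eq0 K S (fun r => r = p \/ r = 0)); last by left.
- by move=> r [->|->] //; rewrite raddf0.
- by move=> j r [->|->]; right; rewrite ?dp ?linear0.
Qed.

Lemma sum_nat_shift (F : nat -> S) (k l : nat) :
  \sum_(k <= r < l) F r = \sum_(0 <= r < l - k) F (r + k)%N.
Proof. by rewrite -{1}[k]add0n big_addn. Qed.

(** This expresses every variable through vertex operators. It is needed for the spanning property
    and, in halved form, is the origin of the alternating sum over [r] in the second formula. *)
Lemma sum_vop_pairs i :
  \sum_(0 <= r < (od i).+1) (-1) ^+ r * B (oz i - r%:Z) (B r 1) = (4 * od i)%:R * X i.
Proof.
have [n nE] : exists n : nat, n = od i by exists (od i).
rewrite -nE; apply/eqP; rewrite -subr_eq0; apply/eqP; apply: der_all_eq0.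
  rewrite raddfB /= rmorphM /= ev0_var mulr0 subr0 raddf_sum big1 // => r _ /=.
  rewrite rmorphM ev0_vop_vop.
  have -> : (n%:Z - r%:Z + r%:Z == 0) = false by lia.
  by rewrite mul0r !mulr0.
(* The derivative of the [r]-th term is [2 (G r - G (r - oz j))], the sign being due to [oz j] being
   odd; the sum telescopes to its boundary. *)
move=> j; pose G (z : int) : S := sg K z *: B (n%:Z - oz j - z) (B z 1).
have dE : d j (\sum_(0 <= r < n.+1) (-1) ^+ r * B (n%:Z - r%:Z) (B r 1)) =
    2%:R * (\sum_(0 <= r < n.+1) G r - \sum_(0 <= r < n.+1) G (r%:Z - oz j)).
  rewrite raddf_sum -sumrB mulr_sumr; apply: eq_bigr => r _ /=.
  rewrite linear_sign /= der_vop der_vop1 vop_natl /G sg_odB scaleNr opprK.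
  rewrite /sg -[_ ^ r%:Z]/(_ ^+ r) !scale_sign.
  have -> : n%:Z - oz j - (r%:Z - oz j) = n%:Z - r%:Z by lia.
  have -> : n%:Z - oz j - r%:Z = n%:Z - r%:Z - oz j by lia.
  ring.
have Gneg z : z < 0 -> G z = 0 by move=> z0; rewrite /G vop_lt0 // linear0 scaler0.
have Gbig z : n%:Z - oz j < z -> G z = if (n == od j) then 2%:R else 0.
  move=> zn; rewrite /G vopC (@vop_lt0 _ _ (_ - z)) ?linear0 ?subr0; last by lia.
  rewrite /car subrK; case: eqP => [e|ne]; last first.
    have -> : (n == od j) = false by lia.
    by rewrite scale0r addr0 scaler0.
  have -> : n == od j by lia.
  by rewrite addr0 e sub0r sgN scalerA mulrCA sg_sq mulr1 scaler_nat.
rewrite linearB /= dE der_natl -[X i]mulr1 der_var der1 mulr0 addr0 mulr1.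
have [nj|[nj|nj]] : (n < od j)%N \/ (od j < n)%N \/ n = od j by lia.
- rewrite [X in _ * (X - _)]big_nat_cond big1; last first.
    by move=> r _; rewrite Gbig; [rewrite ltn_eqF | lia].
  rewrite big_nat_cond big1; last by move=> r /andP[/andP[_ rn] _]; rewrite Gneg //; lia.
  have -> : (j == i) = false by lia.
  by rewrite subrr !mulr0 subrr.
- have -> : (j == i) = false by lia.
  rewrite (@big_cat_nat _ _ _ (n.+1 - od j)) //=; last by lia.
  rewrite [X in _ * (_ + X - _)]big_nat_cond [X in _ * (_ + X - _)]big1 ?addr0; last first.
    by move=> r /andP[/andP[rn _] _]; rewrite Gbig ?gtn_eqF //; lia.
  rewrite [X in _ * (_ - X)](@big_cat_nat _ _ _ (od j)) //=; last by lia.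
  rewrite [X in _ * (_ - (X + _))]big_nat_cond [X in _ * (_ - (X + _))]big1 ?add0r; last first.
    by move=> r /andP[/andP[_ rj] _]; rewrite Gneg //; lia.
  rewrite (sum_nat_shift _ (od j)).
  have -> : \sum_(0 <= r < n.+1 - od j) G ((r + od j)%N%:Z - oz j) =
            \sum_(0 <= r < n.+1 - od j) G r.
    by apply: eq_bigr => r _; congr G; lia.
  by rewrite subrr !mulr0 subrr.
(* Here the first sum is [G 0] plus [n] terms equal to 2 and the second is [G 0]; twice their
   difference is [4 n]. *)
have -> : j == i by lia.
rewrite big_nat_recl //= (@eq_big_nat _ _ _ _ _ _ (fun => 2%:R)) => [|r /andP[_ rn]]; last first.
  by rewrite Gbig ?nj ?eqxx //; lia.
rewrite sumr_const_nat subn0 big_nat_recr //= [X in _ - (X + _)]big_nat_cond [X in _ - (X + _)]big1; last first.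
  by move=> r /andP[/andP[_ rj] _]; rewrite Gneg //; lia.
have -> : G (n%:Z - oz j) = G 0 by congr G; lia.
rewrite add0r addrAC subrr add0r -[_ *+ n]mulr_natr !natrM; ring.
Qed.

(** The terms [r] and [od i - r] coincide: the anticommutation sign cancels against the change of
    parity of the exponent. *)
Lemma sum_vop_half_pairs i :
  \sum_(0 <= r < i.+1) (-1) ^+ r * B (oz i - r%:Z) (B r 1) = (2 * od i)%:R * X i.
Proof.
have := sum_vop_pairs i.
rewrite (@big_cat_nat _ _ _ i.+1) //=; last by lia.
rewrite (sum_nat_shift _ i.+1) (_ : (i.*2.+2 - i.+1 = i.+1)%N); last by lia.
rewrite [X in _ + X]big_nat_rev /=.
have -> : \sum_(0 <= r < i.+1) (-1) ^+ (i.+1 - r.+1 + i.+1) *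
    B (oz i - (i.+1 - r.+1 + i.+1)%N%:Z) (B (i.+1 - r.+1 + i.+1)%N 1) =
    \sum_(0 <= r < i.+1) (-1) ^+ r * B (oz i - r%:Z) (B r 1).
  apply: eq_big_nat => r /andP[_ ri].
  have -> : (i.+1 - r.+1 + i.+1 = od i - r)%N by lia.
  have -> : oz i - (od i - r)%N%:Z = r%:Z by lia.
  have -> : oz i - r%:Z = (od i - r)%N%:Z by lia.
  rewrite vopC car_nat0 ?scale0r ?sub0r; last by lia.
  rewrite -signr_odd oddB ?[odd (od i)]/= ?odd_double; last by lia.
  by rewrite -[in RHS]signr_odd; case: odd; rewrite /= ?expr0 ?expr1 !(mulN1r, mul1r) ?opprK.
rewrite (_ : 4 * od i = 2 * od i + 2 * od i)%N; last by lia.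
rewrite -!mulr2n natrD mulrDl -mulr2n -[LHS]mulr_natl -[RHS]mulr_natl -cst_nat -!scE.
by move/(scalerI (natS_neq0 S 1)).
Qed.

(** [var_vops] carries the variable to 1, where [sum_vop_pairs] writes it through vertex
    operators. *)
Lemma span_var i p : in_span strict p -> in_span strict (X i * p).
Proof.
move=> sp.
have sX : in_span strict (X i).
  have -> : X i = (4 * od i)%:R^-1 *: ((4 * od i)%:R * X i).
    by rewrite -(cst_nat S) -scE scalerK //; apply: (natS_neq0 S).
  apply: in_spanZ; rewrite -sum_vop_pairs; apply: in_span_sum => r.
  rewrite -scale_sign.
  by apply: in_spanZ; do 2!apply: span_vop; apply: span_1.
apply: (sp (fun p => in_span strict (X i * p))) => [|la sla].
  split=> [|c p1 p2 s1 s2]; first by rewrite mulr0; apply: (in_span_closed _).1.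
  by rewrite mulrDr -scalerAr; apply: (in_span_closed _).2.
rewrite var_vops; apply: in_spanD.
  apply: in_spanZ; apply: in_span_sum => j; apply: span_vops; exact: span_1.
by apply: span_vops; rewrite mulr1.
Qed.

Lemma strict_span p : in_span strict p.
Proof.
move: p; apply: carrier_ind; first exact: span_1.
- exact: (in_span_closed strict).2.
- exact: span_var.
Qed.

Lemma form_unique (F : S -> S -> K) :
    (forall p, scalar (F p)) -> (forall p, scalar (F^~ p)) ->
    (forall la mu, strict la -> strict mu ->
       F (vone la) (vone mu) = if la == mu then 2%:R ^+ size la else 0) ->
  forall p r, F p r = form p r.
Proof.
move=> Fr Fl Fs p r.
have F0r x : F x 0 = 0.
  by have := Fr x (-1) 0 0; rewrite scaler0 addr0 mulN1r addNr.
have F0l x : F 0 x = 0.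
  by have := Fl x (-1) 0 0; rewrite scaler0 addr0 mulN1r addNr.
apply: (strict_span p (P := fun p => F p r = form p r)).
  split=> [|c p1 p2 e1 e2]; first by rewrite F0l formC linear0.
  by rewrite Fl formDl formZl e1 e2.
move=> la sla; apply: (strict_span r (P := fun r => F _ r = form _ r)).
  split=> [|c p1 p2 e1 e2]; first by rewrite F0r linear0.
  by rewrite Fr linearP e1 e2.
by move=> mu smu; rewrite Fs // form_vops.
Qed.

(** The radical is closed under derivations, these being adjoint to variables up to nonzero scalars,
    and pairing with 1 gives the constant term. *)
Lemma form_nondeg p : (forall r, form p r = 0) -> p = 0.
Proof.
move=> p0; apply: (@carrier_eq0 K S (fun p => forall r, form p r = 0)) => //.
- by move=> r r0; rewrite -form1 formC.
- move=> i r r0 r'; have := r0 (X i * r').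
  rewrite formC form_var formC => /eqP; rewrite mulf_eq0 invr_eq0.
  by rewrite (negPf (natS_neq0 S _)) => /eqP.
Qed.

End Basis.

(** * Adjoints of the Virasoro operators *)

Section Adjoints.
Variables (K : fieldType) (S : bosonFock K).
Implicit Types (p r : S) (i j : nat) (m n a b : int).

Local Notation X := (@var K S).
Local Notation d := (@der K S).
Local Notation e0 := (@ev0 K S).
Local Notation q := (@qf K S).
Local Notation B := (@vop K S).
Local Notation form := (@form K S).
Local Notation vone la := (vops la (1 : S)).

Lemma der_X i j : d i (X j) = (i == j)%:R.
Proof. by rewrite -[X j]mulr1 der_var der1 mulr0 addr0 mulr1. Qed.

(** [raise s] is [sum_k k t_k d/dt_(k-2s)] and [lower s] is [sum_k k t_k d/dt_(k+2s)]; given by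
    values on the variables, they involve no infinite sum. *)
Definition raise s : {linear S -> S} :=
  @dvn K S (fun i => (od (i + s))%:R * X (i + s)).
Definition lower s : {linear S -> S} :=
  @dvn K S (fun i => if (s <= i)%N then (od (i - s))%:R * X (i - s) else 0).

Lemma ev0_dvn f p : (forall i, e0 (f i) = 0) -> e0 (@dvn K S f p) = 0.
Proof.
move=> f0; move: p; apply: carrier_ind => [|c p p' IH IH'|i p IH].
- by rewrite dvn1 raddf0.
- by rewrite linearP raddfD /= ev0Z IH IH' mulr0 addr0.
- by rewrite dvn_var raddfD /= !rmorphM /= f0 ev0_var !mul0r addr0.
Qed.

Lemma ev0_raise s p : e0 (raise s p) = 0.
Proof. by apply: ev0_dvn => i; rewrite rmorphM /= ev0_var mulr0. Qed.

Lemma ev0_lower s p : e0 (lower s p) = 0.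
Proof.
apply: ev0_dvn => i; case: ifP => _; last exact: raddf0.
by rewrite rmorphM /= ev0_var mulr0.
Qed.

(** A commutator of derivations is a derivation. For [raise] and [lower] its values [g j] are
    constants, nonzero for at most one [j], so [dvn_delta] identifies it with a multiple of a single
    [d k]. *)
Lemma der_dvn f g i p : (forall j, d i (f j) = g j) ->
  d i (@dvn K S f p) = @dvn K S f (d i p) + @dvn K S g p.
Proof.
move=> dfg; move: p; apply: carrier_ind => [|c p p' IH IH'|j p IH].
- by rewrite der1 !dvn1 !linear0 addr0.
- by rewrite !linearP /= IH IH' scalerDr; ring.
have fn (b : nat) r : @dvn K S f (b%:R * r) = b%:R * dvn f r.
  by rewrite !mulr_natl linearMn.
rewrite !dvn_var linearD derM /= !der_var dfg IH (linearD (dvn f)) /= fn dvn_var; ring.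
Qed.

Lemma dvn_delta k c f p : (forall j, f j = c * (j == k)%:R) ->
  @dvn K S f p = c * d k p.
Proof.
move=> fE; move: p; apply: carrier_ind => [|a p p' IH IH'|j p IH].
- by rewrite dvn1 der1 mulr0.
- by rewrite !linearP /= IH IH' !scE; ring.
by rewrite dvn_var der_var IH fE eq_sym; ring.
Qed.

Lemma der_lower s i p : d i (lower s p) = lower s (d i p) + (od i)%:R * d (i + s) p.
Proof.
rewrite (der_dvn _ (fun j => erefl)); congr (_ + _); apply: dvn_delta => j.
case: leqP => sj; last first.
  by rewrite linear0 ltn_eqF ?mulr0 //; lia.
rewrite der_natl der_X.
have -> : (i == j - s)%N = (j == i + s)%N by lia.
by case: eqP => [->|_]; rewrite ?mulr0 // addnK.
Qed.

Lemma der_raise s i p : d i (raise s p) =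
  raise s (d i p) + (if (s <= i)%N then (od i)%:R * d (i - s) p else 0).
Proof.
rewrite (der_dvn _ (fun j => erefl)); congr (_ + _).
have E j : d i ((od (j + s))%:R * X (j + s)) = (od i)%:R * (i == j + s)%:R.
  rewrite der_natl der_X.
  by case: eqP => [->|_]; rewrite ?mulr0.
case: leqP => si.
  apply: dvn_delta => j; rewrite E; congr (_ * _%:R); lia.
rewrite (@dvn_delta 0 0) ?mul0r // => j; rewrite E mul0r ltn_eqF ?mulr0 //; lia.
Qed.

Lemma half_odVK i c : (2 * od i)%:R^-1 * (c * (od i)%:R) = 2%:R^-1 * c :> K.
Proof.
rewrite natrM; move: (natS_neq0 S i.*2) (natS_neq0 S 1).
by move: (od i)%:R => x x0 h2; field; rewrite x0 h2.
Qed.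

Lemma form_natr k p r : form p (k%:R * r) = form p r * k%:R.
Proof. by rewrite mulr_natl linearMn mulr_natr. Qed.

Lemma form_natl k p r : form (k%:R * p) r = form p r * k%:R.
Proof. by rewrite formC form_natr formC. Qed.

Lemma form_lower s p r : form (lower s p) r = form p (raise s r).
Proof.
move: p r; apply: carrier_ind => [|c p p' IH IH'|i p IH] r.
- by rewrite form1 ev0_raise /lower dvn1 formC linear0.
- by rewrite linearP /= !formDl !formZl IH IH'.
rewrite {1}/lower dvn_var -/(lower s) formDl !form_var IH der_raise linearD /=.
rewrite mulrDr addrC; congr (_ + _); case: ifP => si.
  by rewrite -mulrA form_natl form_var -mulrA !form_natr !half_odVK.
by rewrite mul0r linear0 mulr0 formC linear0.
Qed.

Lemma form_raise s p r : form (raise s p) r = form p (lower s r).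
Proof. by rewrite formC -form_lower formC. Qed.

Lemma form_der i p r : form p (d i r) = (2 * od i)%:R * form (X i * p) r.
Proof. by rewrite form_var mulrA mulfV ?mul1r //; apply: (natS_neq0 S). Qed.

Lemma form_varr i p r : form p (X i * r) = (2 * od i)%:R^-1 * form (d i p) r.
Proof. by rewrite formC form_var formC. Qed.

Lemma cstD x y : cst S (x + y) = cst S x + cst S y.
Proof. by rewrite /cst scalerDl. Qed.

Lemma od_vop i n p :
  (od i)%:R * X i * B n p - B n ((od i)%:R * X i * p) = B (n + oz i) p.
Proof.
rewrite -[_ * p]mulrA vop_natl vop_var -(cst_nat S) -mulrA -mulrBr opprB addrCA subrr addr0.
by rewrite -scE scalerA mulfV ?scale1r //; apply: natS_neq0.
Qed.

Lemma odV_scale i x p :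
  (od i)%:R^-1 *: ((x + (oz i)%:~R) *: p) = (od i)%:R^-1 *: (x *: p) + p.
Proof.
by rewrite scalerDl scalerDr [X in _ + X]scalerA mulVf ?scale1r //; apply: (natS_neq0 S).
Qed.

(** Since [d/dt_(k+2) q_n = d/dt_k q_(n-2)], [lower 1] acts on [q_n] as the Euler operator acts on
    [q_(n-2)]. *)
Lemma lower1_vop1 n : lower 1 (B n 1) = (n - 2)%:~R *: B (n - 2) 1.
Proof.
apply/eqP; rewrite -subr_eq0; apply/eqP; move: n.
apply: family_eq0 => [n|j n].
  rewrite raddfB /= ev0_lower ev0Z ev0_vop1 sub0r.
  by case: eqP => [->|_]; rewrite ?mulr0 ?mul0r oppr0.
exists [:: (2, n - oz j)]; rewrite big_seq1 /= linearB linearZ /= der_lower !der_vop1.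
have -> : n - oz (j + 1) = n - oz j - 2 by lia.
have -> : n - 2 - oz j = n - oz j - 2 by lia.
rewrite linear_natl /= !scE.
have -> : (n - 2)%:~R = (n - oz j - 2)%:~R + (od j)%:R :> K.
  by rewrite -[(od j)%:R]/((oz j)%:~R) -intrD; congr (_%:~R); lia.
by rewrite cstD !cst_nat; ring.
Qed.

(** The term with [d 0] accounts for [lower 1] killing [t_1]: without it, the commutation with [t_1]
    would be off by [B (n - 1) p]. *)
Lemma lower1_vop n p :
  lower 1 (B n p) = B n (lower 1 p) + (n - 2)%:~R *: B (n - 2) p - B (n - 1) (d 0 p).
Proof.
move: p n; apply: carrier_ind => [|c p p' IH IH'|j p IH] n.
- by rewrite /lower dvn1 -/(lower 1) der1 !linear0 add0r ?subr0 ?addr0 lower1_vop1.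
- by rewrite !linearP /= IH IH' !scE; ring.
pose f i : S := if (1 <= i)%N then (od (i - 1))%:R * X (i - 1) else 0.
have lX i r : lower 1 (X i * r) = f i * r + X i * lower 1 r by exact: dvn_var.
have fB : B n (f j * p) = f j * B n p - (if j == 0%N then 0 else B (n - 2 + oz j) p).
  rewrite /f; case: j => [|j] /=; first by rewrite !mul0r linear0 subr0.
  rewrite subn1 /= -(_ : n + oz j = n - 2 + oz j.+1); last by lia.
  by rewrite -od_vop opprB addrC subrK.
rewrite vop_var linearB linearZ /= !lX !IH (linearD (B n)) /= fB der_var.
rewrite !(linearD (B (n - 1))) /= !vop_var.
rewrite (_ : n + oz j - 2 = n - 2 + oz j) 1?(_ : n + oz j - 1 = n - 1 + oz j); try lia.
rewrite [(n - 2 + oz j)%:~R]intrD scalerBr scalerDr odV_scale.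
case: (j) => [|j'] /=; last by rewrite mul0r ?linear0 !scE; ring.
have -> : n - 1 = n - 2 + 1 by lia.
by rewrite mul1r !scE; ring.
Qed.

(** This is Euler's identity for [q_(n+4)]: [raise 2] provides the terms [k t_k] with [k >= 5] only,
    and the two subtracted terms are those of [k = 1] and [k = 3]. *)
Lemma raise2_vop1 n : raise 2 (B n 1) =
  (n + 4)%:~R *: B (n + 4) 1 - 2%:R * (X 0 * B (n + 3) 1) - 6%:R * (X 1 * B (n + 1) 1).
Proof.
apply/eqP; rewrite -subr_eq0; apply/eqP; move: n.
apply: family_eq0 => [n|j n].
  rewrite !raddfB /= ev0_raise ev0Z ev0_vop1 !rmorphM /= !ev0_var !(mul0r, mulr0, oppr0, addr0, add0r).
  by case: eqP => [->|_]; rewrite ?mulr0 ?mul0r oppr0.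
exists [:: (2, n - oz j)]; rewrite big_seq1 /= !linearB linearZ /= !linear_natl /= !derM.
rewrite der_raise !der_X !der_vop1 !linear_natl /=.
have [s4 s3 s1] : [/\ n + 4 - oz j = n - oz j + 4, n + 3 - oz j = n - oz j + 3
  & n + 1 - oz j = n - oz j + 1] by split; lia.
have -> : (n + 4)%:~R = (n - oz j + 4)%:~R + (od j)%:R :> K.
  by rewrite -[(od j)%:R]/((oz j)%:~R) -intrD; congr (_%:~R); lia.
rewrite s4 s3 s1 !scE cstD !cst_nat.
case: j {s4 s3 s1} => [|[|j]] /=.
- have -> : n + 3 = n - oz 0 + 4 by lia.
  rewrite -[(od 0)%:R]/(1 : S); ring.
- have -> : n + 1 = n - oz 1 + 4 by lia.
  rewrite -[(od 1)%:R]/(3%:R : S); ring.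
rewrite !subSS subn0; have -> : n - oz j = n - oz j.+2 + 4 by lia.
ring.
Qed.

Lemma var_odV i n p :
  (od i)%:R * (X i * B n p) = B n ((od i)%:R * (X i * p)) + B (n + oz i) p.
Proof. by rewrite -od_vop -!mulrA; ring. Qed.

Lemma raise2_vop n p : raise 2 (B n p) =
  B n (raise 2 p) + (n + 4)%:~R *: B (n + 4) p
  - 2%:R * (X 0 * B (n + 3) p) - 6%:R * (X 1 * B (n + 1) p).
Proof.
move: p n; apply: carrier_ind => [|c p p' IH IH'|j p IH] n.
- by rewrite raise2_vop1 /raise dvn1 linear0 add0r.
- by rewrite !linearP /= IH IH' !scE; ring.
have lX i r : raise 2 (X i * r) = (od (i + 2))%:R * X (i + 2) * r + X i * raise 2 r.
  exact: dvn_var.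
rewrite vop_var linearB linearZ /= !lX !IH (linearD (B n)) /= !vop_var.
have -> : B n ((od (j + 2))%:R * X (j + 2) * p) =
    (od (j + 2))%:R * X (j + 2) * B n p - B (n + 4 + oz j) p.
  rewrite -(_ : n + oz (j + 2) = n + 4 + oz j); last by lia.
  by rewrite -od_vop opprB addrC subrK.
have [-> -> ->] : [/\ n + oz j + 4 = n + 4 + oz j, n + oz j + 3 = n + 3 + oz j
  & n + oz j + 1 = n + 1 + oz j] by split; lia.
rewrite !scalerBr scalerDr [(n + 4 + oz j)%:~R]intrD odV_scale !scE.
ring.
Qed.

Definition dsum la c c' : S :=
  \sum_(i < size la) \sum_(j < size la | j != i)
    vone (addp (addp la i c) j c').

Lemma dsum_cons a la c c' :
  dsum (a :: la) c c' =
    \sum_(i < size la) B (a + c) (vone (addp la i c')) +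
    \sum_(i < size la) B (a + c') (vone (addp la i c)) + B a (dsum la c c').
Proof.
rewrite /dsum big_ord_recl /= [X in X + _]big_mkcond big_ord_recl /= add0r -addrA.
congr (_ + _); rewrite linear_sum -big_split /=; apply: eq_bigr => i _.
rewrite big_mkcond big_ord_recl /= linear_sum; congr (_ + _).
rewrite [RHS]big_mkcond; apply: eq_bigr => j _ /=.
by rewrite (inj_eq lift_inj).
Qed.

Lemma lower1_vops la : lower 1 (vone la) =
  \sum_(i < size la) (la`_i - 2)%:~R *: vone (addp la i (- 2))
  - dsum la (- 1) (- 1).
Proof.
elim: la => [|a la IH] /=.
  by rewrite /lower dvn1 /dsum !big_ord0 subrr.
rewrite lower1_vop IH dsum_cons big_ord_recl /= der_vops der1 linear0 addr0.
move: (dsum la _ _) => D; rewrite linear_natl linearB !linear_sum /=.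
have -> : \sum_(i < size la) B a ((la`_i - 2)%:~R *: vone (addp la i (- 2))) =
    \sum_(i < size la) (la`_i - 2)%:~R *: B a (vone (addp la i (- 2))).
  by apply: eq_bigr => i _; rewrite linearZ.
ring.
Qed.

Lemma odvar_vops i la p :
  (od i)%:R * (X i * vops la p) =
    \sum_(j < size la) vops (addp la j (oz i)) p + vops la ((od i)%:R * (X i * p)).
Proof.
elim: la => [|a la IH] /=; first by rewrite big_ord0 add0r.
by rewrite var_odV IH big_ord_recl linearD linear_sum /= addrC addrA.
Qed.

Lemma var0_vops la p : X 0 * vops la p =
  \sum_(j < size la) vops (addp la j 1) p + vops la (X 0 * p).
Proof. by have := odvar_vops 0 la p; rewrite !mul1r. Qed.

Lemma var1_vops la p : 3%:R * (X 1 * vops la p) =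
  \sum_(j < size la) vops (addp la j 3) p + vops la (3%:R * (X 1 * p)).
Proof. exact: (odvar_vops 1). Qed.

(** The coefficient is [la_i] and not [la_i + 4] because moving [t_1] and [3 t_3] to the right past
    the raised operator gives back [B (n + 4)] twice each. Both variables end up applied to 1. *)
Lemma raise2_vops la : raise 2 (vone la) =
  \sum_(i < size la) (la`_i)%:~R *: vone (addp la i 4)
  - 2%:R * dsum la 3 1
  - 2%:R * \sum_(i < size la) vops (addp la i 3) (X 0 * 1)
  - 2%:R * \sum_(i < size la) vops (addp la i 1) (3%:R * (X 1 * 1)).
Proof.
elim: la => [|a la IH] /=.
  by rewrite /raise dvn1 /dsum !big_ord0 !mulr0 !subr0.
rewrite raise2_vop IH dsum_cons !big_ord_recl /=.
have XB n : X 0 * B n (vone la) = B (n + 1) (vone la) +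
    B n (\sum_(j < size la) vone (addp la j 1) + vops la (X 0 * 1)).
  by rewrite (var0_vops (n :: la)) big_ord_recl /= -addrA linearD linear_sum.
have X3B n : 3%:R * (X 1 * B n (vone la)) = B (n + 3) (vone la) +
    B n (\sum_(j < size la) vone (addp la j 3) + vops la (3%:R * (X 1 * 1))).
  by rewrite (var1_vops (n :: la)) big_ord_recl /= -addrA linearD linear_sum.
rewrite (_ : 6%:R = 2%:R * 3%:R) -?mulrA ?X3B ?XB; last by ring.
move: (dsum la _ _) (X 0 * 1) (3%:R * (X 1 * 1)) => D v0 v1.
rewrite !linearB !linear_natl !linearD !linear_sum /=.
have -> : \sum_(i < size la) B a ((la`_i)%:~R *: vone (addp la i 4)) =
    \sum_(i < size la) (la`_i)%:~R *: B a (vone (addp la i 4)).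
  by apply: eq_bigr => i _; rewrite linearZ.
have [-> ->] : a + 3 + 1 = a + 4 /\ a + 1 + 3 = a + 4 by split; lia.
rewrite intrD scalerDl -[4%:~R]/(4%:R : K) scaler_nat -[_ *+ 4]mulr_natl.
ring.
Qed.

Lemma dsum_eq la c c' : \sum_(i < size la) \sum_(j < size la) vone (addp (addp la i c) j c')
  = \sum_(i < size la) vone (addp la i (c + c')) + dsum la c c'.
Proof.
rewrite /dsum -big_split; apply: eq_bigr => i _; rewrite (bigD1 i) //=; congr (vone _ + _).
by rewrite /addp nth_set_nth /= eqxx set_set_nth eqxx addrA.
Qed.

(** A polynomial involves finitely many variables; this links the derivations [dvn f] to the formal
    infinite sums in the Virasoro operators. *)
Lemma dvn_sum p : exists N0, forall N : nat, (N0 <= N)%N ->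
  d N p = 0 /\ forall f, @dvn K S f p = \sum_(i < N) f i * d i p.
Proof.
move: p; apply: carrier_ind => [|c p p' [N1 h1] [N2 h2]|j p [N1 h1]].
- exists 0%N => N _; split=> [|f]; first exact: der1.
  by rewrite dvn1 big1 // => i _; rewrite der1 mulr0.
- exists (maxn N1 N2) => N; rewrite geq_max => /andP[/h1[d1 e1] /h2[d2 e2]].
  split=> [|f]; first by rewrite linearP d1 d2 scaler0 addr0.
  rewrite linearP e1 e2 scaler_sumr -big_split; apply: eq_bigr => i _ /=.
  by rewrite linearP mulrDr scalerAr.
exists (maxn N1 j.+1) => N; rewrite geq_max => /andP[/h1[d1 e1] jN].
split=> [|f]; first by rewrite der_var d1 gtn_eqF // mul0r mulr0 addr0.
rewrite dvn_var e1 mulr_sumr (bigD1 (Ordinal jN)) //= [RHS](bigD1 (Ordinal jN)) //=.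
rewrite der_var eqxx mul1r mulrDr -addrA mulrCA; congr (_ + (_ + _)).
apply: eq_bigr => i ij; rewrite der_var.
have -> : (i == j :> nat) = false by apply/negbTE; rewrite -(inj_eq val_inj) in ij.
by rewrite mul0r add0r mulrCA.
Qed.

Variable h : K.

(** The constants here and in [L2adj] come from replacing [t_k] by [d/dt_k / (2k)], [d/dt_k] by
    [2k t_k], and exchanging [raise] with [lower]. *)
Definition Lm1adj p : S :=
  16%:R^-1 *: d 0 (d 0 p) + 2%:R^-1 *: lower 1 p - h^-1 *: (X 0 * p).

Definition L2adj p : S :=
  2%:R^-1 *: raise 2 p + 6%:R *: (X 0 * (X 1 * p)) - (7%:R / h) *: (X 3 * p).

Lemma form_Lm1adj p r : form (Lm1adj p) r =
  form p (4%:R^-1 *: (X 0 * X 0 * r) + 2%:R^-1 *: raise 1 r - (2%:R * h)^-1 *: d 0 r).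
Proof.
rewrite /Lm1adj formBl formDl !formZl linearB linearD !linearZ /= form_lower.
rewrite -mulrA !form_varr !form_der [2%:R * h]mulrC invfM.
move: (natS_neq0 S 1) => h2; congr (_ + _ - _).
  rewrite !mulrA; congr (_ * _); rewrite !muln1.
  by rewrite -!invfM -!natrM.
by rewrite !mulrA mulfVK.
Qed.

Lemma form_L2adj p r : form (L2adj p) r =
  form p (2%:R^-1 *: lower 2 r + 2%:R^-1 *: d 0 (d 1 r) - (2%:R * h)^-1 *: d 3 r).
Proof.
rewrite /L2adj formBl formDl !formZl linearB linearD !linearZ /= form_raise.
rewrite !form_der [2%:R * h]mulrC invfM; move: (natS_neq0 S 1) => h2.
congr (_ + _ - _); rewrite !mulrA; congr (_ * _).
  by rewrite (_ : (2 * od 0)%:R = 2%:R :> K) // mulVf // mul1r.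
  by rewrite [X 0 * _]mulrC.
have -> : (2 * od 3)%:R = 2%:R * 7%:R :> K by rewrite -natrM.
by rewrite !mulrA mulfVK // mulrC.
Qed.

Local Notation Q := (genQ q).

Lemma strict_ge0 la : strict la -> all (fun x => 0 <= x) la.
Proof. by case/andP=> _; apply: sub_all => x /ltW. Qed.

Lemma addp_ge0 la i (c : int) : all (fun x => 0 <= x) la -> (i < size la)%N ->
  0 <= la`_i + c -> all (fun x => 0 <= x) (addp la i c).
Proof.
move=> /(all_nthP 0) la0 il ic; apply/(all_nthP 0) => j.
rewrite size_addp // => jl; rewrite nth_addp.
by case: eqP => [->|_] //; rewrite addr0 la0.
Qed.

Lemma genQ_addp la i (c : int) : strict la -> (i < size la)%N -> -1 <= c ->
  Q (addp la i c) = vone (addp la i c).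
Proof.
move=> sla il c1; apply: genQ_ge0; apply: addp_ge0 => //; first exact: strict_ge0.
by case/andP: sla => _ /(all_nthP 0) /(_ _ il) /=; lia.
Qed.

Lemma genQ_addp_cat la i (c : int) mu : strict la -> (i < size la)%N -> 0 <= c ->
  all (fun x => 0 <= x) mu -> Q (addp la i c ++ mu) = vone (addp la i c ++ mu).
Proof.
move=> sla il c0 mu0; apply: genQ_ge0; rewrite all_cat mu0 andbT.
apply: addp_ge0 => //; first exact: strict_ge0.
by case/andP: sla => _ /(all_nthP 0) /(_ _ il) /=; lia.
Qed.

Lemma genQ_addp2 la i j (c c' : int) : strict la -> (i < size la)%N -> (j < size la)%N ->
  i != j -> -1 <= c -> -1 <= c' ->
  Q (addp (addp la i c) j c') = vone (addp (addp la i c) j c').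
Proof.
move=> sla il jl ij c1 c1'; have /andP[_ /(all_nthP 0) pos] := sla.
apply: genQ_ge0; apply: addp_ge0; rewrite ?size_addp //.
  apply: addp_ge0 => //; first exact: strict_ge0.
  by have /= := pos _ il; lia.
rewrite nth_addp eq_sym (negPf ij) addr0.
have /= := pos _ jl; move: (la`_j) c1' => y {}c1'; lia.
Qed.

(* [la] being strict, a part equal to [1] is the last one. *)
Lemma genQ_addpN2 la i : strict la -> (i < size la)%N ->
  Q (addp la i (- 2)) = vone (addp la i (- 2)).
Proof.
move=> sla il; have [la2|la1] := leP 2 la`_i.
  apply: genQ_ge0; apply: addp_ge0; rewrite ?strict_ge0 //.
  by move: (la`_i) la2 => y; lia.
have /andP[srt /(all_nthP 0) pos] := sla.
have [il'|li] := ltnP i.+1 (size la).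
  have tr : transitive (fun x y : int => y < x).
    by move=> x y z /= yx zy; apply: lt_trans yx.
  have /= := sorted_ltn_nth tr 0 srt i i.+1 il il' (ltnSn i).
  have /= := pos _ il'; move: la1; move: (la`_i) (la`_i.+1) => y z; lia.
case/lastP: la sla il li la1 {srt} pos => // la x; rewrite !size_rcons ltnS => sla il.
rewrite ltnS => li; have -> : i = size la by lia.
rewrite /addp nth_rcons ltnn eqxx => x2 /(_ (size la)).
rewrite ltnSn nth_rcons ltnn eqxx => /(_ isT) x0.
have -> : set_nth 0 (rcons la x) (size la) (x - 2) = rcons la (x - 2).
  by elim: (la) => //= y s ->.
apply: genQ_rcons_lt0; last by lia.
by have := strict_ge0 sla; rewrite all_rcons => /andP[].
Qed.

Lemma halfZ p r : 2%:R * p = r -> p = 2%:R^-1 *: r.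
Proof. by move=> <-; rewrite -(cst_nat S) -scE scalerK //; apply: (natS_neq0 S 1). Qed.

Lemma vopsZ la c p : vops la (c *: p) = c *: vops la p.
Proof. exact: linearZ. Qed.

Lemma vopsB la p r : vops la (p - r) = vops la p - vops la r.
Proof. exact: linearB. Qed.

Lemma halfD p : 2%:R^-1 *: p + 2%:R^-1 *: p = p.
Proof.
rewrite -scalerDl (_ : _ + _ = 1) ?scale1r //.
by move: (natS_neq0 S 1) => h2; field.
Qed.

Lemma var0E : X 0 = 2%:R^-1 *: B 1 1.
Proof.
apply: halfZ; have := sum_vop_half_pairs S 0.
by rewrite big_nat1 expr0 mul1r vop0 => ->.
Qed.

Lemma var1E : 3%:R * X 1 = 2%:R^-1 *: (B 3 1 - B 2 (B 1 1)).
Proof.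
apply: halfZ; have := sum_vop_half_pairs S 1.
rewrite big_nat_recr //= big_nat1 expr0 expr1 mul1r vop0 mulN1r => E.
by rewrite mulrA -natrM; exact: (esym E).
Qed.

(** [t_1] is moved through both terms of [var1E] and becomes [B 1 1 / 2] at the end; the terms
    containing [B 1] or [B 2] squared vanish. *)
Lemma var01E : 6%:R *: (X 0 * (X 1 * 1)) = B 4 1 - 2%:R^-1 *: B 3 (B 1 1).
Proof.
have -> : 6%:R *: (X 0 * (X 1 * 1)) = 2%:R * (X 0 * (3%:R * X 1)).
  by rewrite scE cst_nat; ring.
rewrite var1E -scalerAr -[2%:R](cst_nat S) -scE scalerA mulfV ?scale1r; last exact: (natS_neq0 S 1).
have b3 := var0_vops [:: 3] 1; have b21 := var0_vops [:: 2; 1] 1.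
move: b3 b21; rewrite !big_ord_recl !big_ord0 /= mulr1 var0E => b3 b21.
rewrite mulrBr b3 b21 !addr0 !linearZ /= (vop_sq _ (a := 1)) // linear0 scaler0 addr0.
rewrite (vop_sq _ (a := 2)) // addr0 scalerN.
rewrite -[B (3 + 1) 1]/(B 4 1) -[B (2 + 1) _]/(B 3 (B 1 1)).
by rewrite -[X in _ - X = _]halfD; ring.
Qed.

Lemma var3E : 7%:R *: X 3 =
  2%:R^-1 *: \sum_(r < 4) (-1) ^+ r *: B (7 - r%:Z) (B r%:Z 1).
Proof.
rewrite scE cst_nat; apply: halfZ; have := sum_vop_half_pairs S 3.
rewrite big_mkord => E; rewrite mulrA -natrM -E.
by apply: eq_bigr => r _; rewrite scale_sign.
Qed.

Lemma der0_der0_vops la : d 0 (d 0 (vone la)) =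
  4%:R * (\sum_(i < size la) vone (addp la i (- 2)) + dsum la (- 1) (- 1)).
Proof.
rewrite -(dsum_eq _ (- 1) (- 1)) der_vops der1 linear0 addr0 der_natl linear_sum mulr_sumr.
rewrite mulr_sumr; apply: eq_bigr => i _; rewrite /= der_vops der1 linear0 addr0.
by rewrite size_addp // mulrA -natrM.
Qed.

(** The second derivative gives [1/4] both to [la - 2 epsilon_i] and to the double sum, half of
    [lower 1] gives [(la_i - 2)/2] and [-1/2]; the totals are [(2 la_i - 3)/4] and [-1/4]. *)
Lemma Lm1adj_genQ la : strict la ->
  Lm1adj (Q la) =
      - (4%:R^-1 *: \sum_(i < size la) \sum_(j < size la | j != i)
                      Q (addp (addp la i (- 1)) j (- 1)))
      + \sum_(i < size la) ((2 * la`_i - 3)%:~R / 4%:R) *: Q (addp la i (- 2))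
      - h^-1 *: (\sum_(i < size la) Q (addp la i 1) + 2%:R^-1 *: Q (la ++ [:: 1])).
Proof.
move=> sla.
have -> : \sum_(i < size la) \sum_(j < size la | j != i)
    Q (addp (addp la i (- 1)) j (- 1)) = dsum la (- 1) (- 1).
  apply: eq_bigr => i _; apply: eq_bigr => j ji.
  by rewrite genQ_addp2 // eq_sym.
under eq_bigr do rewrite genQ_addpN2 //.
under [X in h^-1 *: (X + _)]eq_bigr do rewrite genQ_addp //.
rewrite !genQ_ge0 ?all_cat ?strict_ge0 //.
rewrite /Lm1adj var0_vops lower1_vops vops_cat /= mulr1 var0E [vops la (_ *: _)]linearZ der0_der0_vops /=.
congr (_ - _); have -> : \sum_(i < size la) ((2 * la`_i - 3)%:~R / 4%:R) *: vone (addp la i (- 2)) =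
   4%:R^-1 *: \sum_(i < size la) vone (addp la i (- 2)) +
   2%:R^-1 *: \sum_(i < size la) (la`_i - 2)%:~R *: vone (addp la i (- 2)).
  rewrite !scaler_sumr -big_split; apply: eq_bigr => i _ /=.
  rewrite scalerA -scalerDl; congr (_ *: _).
  rewrite !rmorphB !rmorphM /=; move: (natS_neq0 S 1) (natS_neq0 S 3).
  by move=> h2 h4; field; rewrite h2 h4.
move: (\sum_(i < size la) vone (addp la i (- 2)))
  (\sum_(i < size la) (la`_i - 2)%:~R *: vone (addp la i (- 2)))
  (dsum la (- 1) (- 1)) => s1 s2 s3.
have -> : 4%:R * (s1 + s3) = 4%:R *: (s1 + s3) by rewrite scE cst_nat.
have e4 : 16%:R^-1 * 4%:R = 4%:R^-1 :> K.
  by move: (natS_neq0 S 15) (natS_neq0 S 3) => h16 h4; field; rewrite h16 h4.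
have e2 : 2%:R^-1 = 4%:R^-1 + 4%:R^-1 :> K.
  by move: (natS_neq0 S 1) (natS_neq0 S 3) => h2 h4; field; rewrite h2 h4.
by rewrite scalerA e4 e2 !scE cstD; ring.
Qed.

(** Half of [raise 2] contributes [-1] and [6 t_1 t_3] contributes [2] to the double sum and to the
    sums with [t_1] or [3 t_3] left on 1; hence the total 1. Likewise [la_i / 2 + 2] is
    [(la_i + 4)/2]. *)
Lemma L2adj_genQ la : strict la ->
  L2adj (Q la) =
      \sum_(i < size la) \sum_(j < size la | j != i) Q (addp (addp la i 3) j 1)
      + \sum_(i < size la) ((la`_i + 4)%:~R / 2%:R) *: Q (addp la i 4)
      + 2%:R^-1 *: (\sum_(i < size la) Q (addp la i 3 ++ [:: 1]))
      + 2%:R^-1 *: (\sum_(i < size la) Q (addp la i 1 ++ [:: 3]))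
      - 2%:R^-1 *: (\sum_(i < size la) Q (addp la i 1 ++ [:: 2; 1]))
      + Q (la ++ [:: 4])
      - 2%:R^-1 *: Q (la ++ [:: 3; 1])
      - h^-1 *: (\sum_(i < size la) Q (addp la i 7)
                    + 2%:R^-1 *: \sum_(r < 4) (-1) ^+ r *: Q (la ++ [:: 7 - r%:Z; r%:Z])).
Proof.
move=> sla.
have -> : \sum_(i < size la) \sum_(j < size la | j != i)
    Q (addp (addp la i 3) j 1) = dsum la 3 1.
  apply: eq_bigr => i _; apply: eq_bigr => j ji.
  by rewrite genQ_addp2 // eq_sym.
have Q4 : \sum_(i < size la) ((la`_i + 4)%:~R / 2%:R) *: Q (addp la i 4) =
    2%:R^-1 *: (\sum_(i < size la) (la`_i)%:~R *: vone (addp la i 4)) +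
    2%:R *: \sum_(i < size la) vone (addp la i 4).
  rewrite !scaler_sumr -big_split; apply: eq_bigr => i _ /=.
  rewrite genQ_addp // scalerA -scalerDl; congr (_ *: _).
  rewrite rmorphD /=; move: (natS_neq0 S 1).
  by move=> h2; field; rewrite h2.
have Qc c mu : 0 <= c -> all (fun x => 0 <= x) mu ->
    \sum_(i < size la) Q (addp la i c ++ mu) =
    \sum_(i < size la) vops (addp la i c) (vone mu).
  move=> c0 mu0; apply: eq_bigr => i _.
  by rewrite genQ_addp_cat // vops_cat.
have Q7 : \sum_(i < size la) Q (addp la i 7) = \sum_(i < size la) vone (addp la i 7).
  by apply: eq_bigr => i _; rewrite genQ_addp.
have Q7r : \sum_(r < 4) (-1) ^+ r *: Q (la ++ [:: 7 - r%:Z; r%:Z]) =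
    vops la (\sum_(r < 4) (-1) ^+ r *: B (7 - r%:Z) (B r%:Z 1)).
  rewrite linear_sum; apply: eq_bigr => r _ /=; rewrite linearZ /= genQ_ge0 ?vops_cat //.
  rewrite all_cat strict_ge0 //= andbT; have := ltn_ord r; lia.
rewrite Q4 !Qc // Q7 Q7r !(genQ_ge0 S (la := _ ++ _)) ?all_cat ?strict_ge0 //.
rewrite genQ_ge0 ?strict_ge0 // !vops_cat /=.
rewrite /L2adj; congr (_ - _); last first.
  have -> : (7%:R / h) *: (X 3 * vone la) = h^-1 *: (7%:R * (X 3 * vone la)).
    by rewrite -[7%:R in RHS](cst_nat S) -scE scalerA mulrC.
  rewrite (odvar_vops 3) mulr1 -(cst_nat S) -scE var3E.
  by rewrite [vops la (_ *: _)]linearZ.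
have w1E : 3%:R * (X 1 * 1) = 2%:R^-1 *: (B 3 1 - B 2 (B 1 1)) by rewrite mulr1 var1E.
have X01 : 6%:R *: (X 0 * (X 1 * vone la)) = 2%:R * (
    \sum_(i < size la) vone (addp la i 4) + dsum la 3 1 +
    \sum_(i < size la) vops (addp la i 3) (X 0 * 1) +
    \sum_(i < size la) vops (addp la i 1) (3%:R * (X 1 * 1))) +
    vops la (6%:R *: (X 0 * (X 1 * 1))).
  have -> p : 6%:R *: (X 0 * (X 1 * p)) = 2%:R * (X 0 * (3%:R * (X 1 * p))).
    by rewrite scE cst_nat; ring.
  have -> p : 6%:R *: (X 0 * (X 1 * p)) = 2%:R * (X 0 * (3%:R * (X 1 * p))).
    by rewrite scE cst_nat; ring.
  rewrite var1_vops mulrDr var0_vops mulr_sumr -(dsum_eq la 3 1) linear_natl /=.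
  under eq_bigr => i _ do rewrite var0_vops size_addp //.
  by rewrite big_split /=; ring.
have lin (c : int) x p r : \sum_(i < size la) vops (addp la i c) (x *: (p - r)) =
    x *: (\sum_(i < size la) vops (addp la i c) p - \sum_(i < size la) vops (addp la i c) r).
  rewrite -sumrB scaler_sumr; apply: eq_bigr => i _.
  by rewrite linearZ linearB.
have linZ (c : int) x p : \sum_(i < size la) vops (addp la i c) (x *: p) =
    x *: (\sum_(i < size la) vops (addp la i c) p).
  by rewrite scaler_sumr; apply: eq_bigr => i _; rewrite linearZ.
have w0E : X 0 * 1 = 2%:R^-1 *: B 1 1 by rewrite mulr1 var0E.
rewrite X01 var01E raise2_vops w1E w0E lin linZ vopsB vopsZ.
move: (dsum la 3 1) => D; rewrite !scalerBr !scE !cst_nat.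
have h2 : cst S 2%:R^-1 * 2%:R = 1.
  by rewrite -(cst_nat S) -scE /cst scalerA mulVf ?scale1r //; apply: (natS_neq0 S 1).
move: (cst S _) h2 => c h2; rewrite !mulrDr !mulrN !mulrA h2.
rewrite ![2%:R * c]mulrC h2.
move: (\sum_(i < size la) vops (addp la i 3) _) (\sum_(i < size la) vops (addp la i 1) (B 3 1))
  (\sum_(i < size la) vops (addp la i 1) (B 2 _)) => u v v'.
(* [ring] sees [c] as an unknown, while it stands for [1/2]: the two sides differ by a multiple of
   [1 - 2 c]. *)
apply/eqP; rewrite -subr_eq0; apply/eqP; transitivity ((1 - c * 2%:R) * (u + v - v')).
  ring.
by rewrite h2 subrr mul0r.
Qed.

End Adjoints.

(** * The polynomial ring *)

Section Build.
Variables (K : fieldType) (A : comAlgType K).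
Hypothesis charK : [pchar K] =i pred0.
Variables (T : nat -> A) (d : nat -> {linear A -> A}) (e0 : {rmorphism A -> K}).
Hypothesis e0Z : forall c p, e0 (c *: p) = c * e0 p.
Hypothesis e0T : forall i, e0 (T i) = 0.
Hypothesis d1 : forall i, d i 1 = 0.
Hypothesis d_varM : forall i j p, d i (T j * p) = (i == j)%:R *: p + T j * d i p.
Hypothesis A_ind : forall P : A -> Prop,
  P 1 -> (forall c p q, P p -> P q -> P (c *: p + q)) ->
  (forall i p, P p -> P (T i * p)) -> forall p, P p.
Hypothesis A_eq0 : forall P : A -> Prop,
  (forall p, P p -> e0 p = 0) -> (forall i p, P p -> P (d i p)) ->
  forall p, P p -> p = 0.
Hypothesis A_rec : forall (V : lmodType K) (x : nat -> V -> V) (v : V),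
  (forall i, linear (x i)) -> (forall i j u, x i (x j u) = x j (x i u)) ->
  {f : A -> V | [/\ linear f, f 1 = v & forall i p, f (T i * p) = x i (f p)]}.

Lemma nat_scale (k : nat) (p : A) : (k%:R : K) *: p = k%:R * p.
Proof. by rewrite scaler_nat mulr_natl. Qed.

Lemma d_varM' i j p : d i (T j * p) = (i == j)%:R * p + T j * d i p.
Proof. by rewrite d_varM nat_scale. Qed.

Lemma dT i j : d i (T j) = (i == j)%:R.
Proof. by rewrite -[T j]mulr1 d_varM' d1 mulr0 addr0 mulr1. Qed.

Lemma dM i p r : d i (p * r) = d i p * r + p * d i r.
Proof.
move: p; apply: A_ind => [|c p p' IH IH'|j p IH].
- by rewrite d1 mul0r !mul1r add0r.
- rewrite mulrDl -!scalerAl !linearP /= IH IH' scalerDr !mulrDl -!scalerAl.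
  by rewrite -!addrA; congr (_ + _); rewrite addrCA.
by rewrite -!mulrA !d_varM' IH; ring.
Qed.

Lemma dC i j p : d i (d j p) = d j (d i p).
Proof.
move: p; apply: A_ind => [|c p p' IH IH'|k p IH].
- by rewrite !d1 !linear0.
- by rewrite !linearP /= IH IH'.
by rewrite !d_varM !linearP /= !d_varM IH; rewrite addrCA.
Qed.

Definition genE N : {poly A} := \sum_(i < N.+1 | odd i) (2%:R * T i./2) *: 'X^i.

Definition genq k : A :=
  (\sum_(j < k.+1) ((j`!%:R^-1 : K)%:A : A) *: genE k ^+ j)`_k.

Lemma coef_genE N i :
  (genE N)`_i = if odd i && (i <= N)%N then 2%:R * T i./2 else 0.
Proof.
rewrite /genE coef_sum; case: ifP => [/andP[oi iN]|nc].
  rewrite (bigD1 (Ordinal (iN : (i < N.+1)%N))) //= coefZ coefXn eqxx mulr1.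
  rewrite big1 ?addr0 // => k /andP[_]; rewrite -val_eqE /= => ki.
  by rewrite coefZ coefXn eq_sym (negPf ki) mulr0.
rewrite big1 // => k ok; rewrite coefZ coefXn; case: eqP => [e|_]; last exact: mulr0.
by move: nc; rewrite e ok -ltnS ltn_ord.
Qed.

Lemma coef_genE_stable N l j i : (i <= l)%N -> (l <= N)%N ->
  (genE N ^+ j)`_i = (genE l ^+ j)`_i.
Proof.
move=> + lN; elim: j i => [|j IH] i il; first by rewrite !expr0.
rewrite !exprS !coefM; apply: eq_bigr => k _.
rewrite IH; last by apply: leq_trans il; apply: leq_subr.
have kl : (k <= l)%N by apply: leq_trans il; rewrite -ltnS ltn_ord.
by rewrite !coef_genE kl (leq_trans kl lN).
Qed.

Lemma coef_genE_small N j i : (i < j)%N -> (genE N ^+ j)`_i = 0.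
Proof.
elim: j i => // j IH i ij; rewrite exprS coefM big1 // => k _.
case: k => -[|k] kj /=; first by rewrite coef_genE /= mul0r.
by rewrite IH ?mulr0 //; lia.
Qed.

(** The exponent has no constant term, so higher powers and higher variables do not reach the
    coefficient of degree [l]. This reconciles the truncations at [k] and at [k - od i] in
    [d_genq]. *)
Lemma genq_stable N M l : (l <= N)%N -> (l <= M)%N ->
  (\sum_(j < M.+1) ((j`!%:R^-1 : K)%:A : A) *: genE N ^+ j)`_l = genq l.
Proof.
move=> lN lM; rewrite /genq !coef_sum.
rewrite (big_ord_widen M.+1 (fun j => (((j`!%:R^-1 : K)%:A : A) *: genE l ^+ j)`_l)) //.
rewrite [RHS]big_mkcond; apply: eq_bigr => j _; rewrite !coefZ.
rewrite (coef_genE_stable _ (leqnn l) lN); case: ltnP => // lj.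
by rewrite coef_genE_small // mulr0.
Qed.

Definition dpoly i (p : {poly A}) : {poly A} := map_poly (d i) p.

Lemma coef_dpoly i p k : (dpoly i p)`_k = d i p`_k.
Proof. by rewrite coef_map_id0 // linear0. Qed.

Lemma dpolyM i p r : dpoly i (p * r) = dpoly i p * r + p * dpoly i r.
Proof.
apply/polyP => k; rewrite coefD coef_dpoly !coefM linear_sum -big_split.
by apply: eq_bigr => l _; rewrite /= dM !coef_dpoly.
Qed.

Lemma dpolyX i p j : dpoly i (p ^+ j) = p ^+ j.-1 * dpoly i p *+ j.
Proof.
elim: j => [|j IH].
  by apply/polyP => k; rewrite coef_dpoly expr0 mulr0n coef0 coef1; case: eqP => _; rewrite ?d1 ?linear0.
rewrite exprS dpolyM IH /= mulrnAr mulrA.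
case: j {IH} => [|j] /=; first by rewrite mulr0n addr0 expr0 mulr1 mul1r.
by rewrite -exprS mulrC -mulrS.
Qed.

Lemma dpoly_genE i N : dpoly i (genE N) = if (od i <= N)%N then 2%:R *: 'X^(od i) else 0.
Proof.
have d2 p : d i (2%:R * p) = 2%:R * d i p by rewrite !mulr_natl linearMn.
apply/polyP => k; rewrite coef_dpoly coef_genE.
rewrite (fun_if (fun p : {poly A} => p`_k)) coef0 coefZ coefXn.
case: ifP => [/andP[ok kN]|nc].
  rewrite d2 dT; have [ki|ik] := eqVneq k (od i).
    by move: kN; rewrite ki /= uphalf_double eqxx => ->.
  have -> : (i == k./2) = false by apply/negbTE/negP => /eqP e; case/eqP: ik; lia.
  by rewrite !mulr0; case: ifP.
rewrite linear0; case: ifP => // iN; case: eqP => [e|_]; last by rewrite mulr0.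
by move: nc; rewrite e /= odd_double iN.
Qed.

Lemma dA i c : d i (c%:A) = 0.
Proof. by rewrite linearZ /= d1 scaler0. Qed.

Lemma d_genq i k :
  d i (genq k) = if (od i <= k)%N then 2%:R * genq (k - od i) else 0.
Proof.
rewrite /genq -coef_dpoly.
have -> : dpoly i (\sum_(j < k.+1) ((j`!%:R^-1 : K)%:A : A) *: genE k ^+ j) =
   \sum_(j < k.+1) ((j`!%:R^-1 : K)%:A : A) *: dpoly i (genE k ^+ j).
  apply/polyP => l; rewrite coef_dpoly !coef_sum linear_sum; apply: eq_bigr => j _ /=.
  by rewrite !coefZ dM dA mul0r add0r coef_dpoly.
under eq_bigr do rewrite dpolyX dpoly_genE.
case: ifP => ik; last by rewrite big1 ?coef0 // => j _; rewrite mulr0 mul0rn scaler0.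
rewrite big_ord_recl mulr0n scaler0 add0r /=.
have k0 : (0 < k)%N by apply: leq_trans ik.
have -> : \sum_(j < k) (((bump 0 j)`!%:R^-1 : K)%:A : A) *:
    (genE k ^+ (bump 0 j).-1 * (2%:R *: 'X^(od i)) *+ bump 0 j) =
    2%:R *: ((\sum_(j < k) ((j`!%:R^-1 : K)%:A : A) *: genE k ^+ j) * 'X^(od i)).
  rewrite mulr_suml scaler_sumr; apply: eq_bigr => j _; rewrite /bump add1n /=.
  rewrite -scalerAr -[_ *+ j.+1]scaler_nat -scalerAl !scalerA; congr (_ *: _).
  rewrite [RHS]mulrC; congr (_ * _).
  rewrite mulr_algl -[j.+1%:R : A](scaler_nat _ (1 : A)) scalerA; congr (_ *: _).
  rewrite factS natrM invfM mulrAC mulVf ?mul1r //.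
  by rewrite ((pcharf0P K).1 charK).
rewrite coefZ coefMXn ltnNge ik /=; congr (_ * _).
by case: k k0 ik => // k _ ik; apply: genq_stable; lia.
Qed.

Lemma e0_genq k : e0 (genq k) = (k == 0%N)%:R.
Proof.
rewrite /genq coef_sum raddf_sum big_ord_recl /= big1 ?addr0 => [|j _].
  by rewrite fact0 invr1 scale1r coefZ mul1r expr0 coef1 rmorph_nat.
rewrite coefZ exprS coefM rmorphM raddf_sum big1 ?mulr0 //= => l _.
rewrite rmorphM coef_genE; case: ifP => _; last by rewrite raddf0 mul0r.
by rewrite rmorphM e0T mulr0 mul0r.
Qed.

(** The polynomial ring is free on 1 under its commuting multiplications by variables, so commuting
    linear maps [x i] and a vector [v] determine a linear map. The operators and the form below are
    built this way, each with its own [V]. *)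
Definition oprec (V : lmodType K) x v xl xC : A -> V := sval (@A_rec V x v xl xC).

Lemma oprecP V x v xl xC : let f := @oprec V x v xl xC in
  [/\ linear f, f 1 = v & forall i p, f (T i * p) = x i (f p)].
Proof. exact: (proj2_sig (@A_rec V x v xl xC)). Qed.

(** All [vop n] are built at once as functions of [n], because the rule for [n] refers to
    [n + oz i]. *)
Definition vop_var_step i (f : int -> A) : int -> A :=
  fun n => T i * f n - (od i)%:R^-1 *: f (n + oz i).

Definition vop_init (n : int) : A := if n is Posz k then genq k else 0.

Lemma vop_step_linear i : linear (vop_var_step i : (int -> A) -> (int -> A)).
Proof.
move=> c f g; apply: (@boolp.funext int A) => n; rewrite /vop_var_step !fctE.
by rewrite mulrDr -!scalerAr scalerDr opprD addrACA scalerBr !scalerA [c * _]mulrC.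
Qed.

Lemma vop_step_comm i j (f : int -> A) :
  vop_var_step i (vop_var_step j f) = vop_var_step j (vop_var_step i f).
Proof.
apply: (@boolp.funext int A) => n; rewrite /vop_var_step.
rewrite !mulrBr !scalerBr -!scalerAr !scalerA !opprB.
have -> : n + oz i + oz j = n + oz j + oz i by lia.
rewrite mulrCA [_^-1 * _^-1]mulrC addrACA [in RHS]addrACA.
by congr (_ + _); exact: addrC.
Qed.

Definition genvop n p : A := oprec vop_init vop_step_linear vop_step_comm p n.

Lemma genvop_linear n : linear (genvop n).
Proof.
move=> c p r; rewrite /genvop.
by case: (oprecP vop_init vop_step_linear vop_step_comm) => /= -> _ _.
Qed.
HB.instance Definition _ n :=
  GRing.isLinear.Build K A A *:%R (genvop n) (genvop_linear n).

Lemma genvop1 n : genvop n 1 = vop_init n.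
Proof.
rewrite /genvop.
by case: (oprecP vop_init vop_step_linear vop_step_comm) => /= _ -> _.
Qed.

Lemma genvop_var n i p : genvop n (T i * p) =
  T i * genvop n p - (od i)%:R^-1 *: genvop (n + oz i) p.
Proof.
rewrite /genvop.
by case: (oprecP vop_init vop_step_linear vop_step_comm) => /= _ _ ->.
Qed.

(** The pair holds a polynomial and its image, since the Leibniz rule needs both. *)
Definition dvn_step (f : nat -> A) i (u : A * A) : A * A :=
  (T i * u.1, f i * u.1 + T i * u.2).

Lemma dvn_step_linear f i : linear (dvn_step f i).
Proof.
move=> c [u v] [u' v']; rewrite /dvn_step /=; congr (_, _).
  by rewrite mulrDr -scalerAr.
by rewrite !mulrDr -!scalerAr addrACA -scalerDr.
Qed.

Lemma dvn_step_comm f i j u : dvn_step f i (dvn_step f j u) = dvn_step f j (dvn_step f i u).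
Proof. by rewrite /dvn_step /=; congr (_, _); ring. Qed.

Definition dvn_pair f := oprec (1, 0) (dvn_step_linear f) (dvn_step_comm f).
Definition gendvn f p : A := (dvn_pair f p).2.

Lemma gendvn_linear f : linear (gendvn f).
Proof.
move=> c p r; rewrite /gendvn /dvn_pair.
by case: (oprecP (1, 0) (dvn_step_linear f) (dvn_step_comm f)) => /= -> _ _.
Qed.
HB.instance Definition _ f :=
  GRing.isLinear.Build K A A *:%R (gendvn f) (gendvn_linear f).

Lemma gendvn1 f : gendvn f 1 = 0.
Proof.
rewrite /gendvn /dvn_pair.
by case: (oprecP (1, 0) (dvn_step_linear f) (dvn_step_comm f)) => /= _ -> _.
Qed.

Lemma dvn_pair1 f p : (dvn_pair f p).1 = p.
Proof.
rewrite /dvn_pair; have [/= lin f1 fT] := oprecP (1, 0) (dvn_step_linear f) (dvn_step_comm f).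
move: p; apply: A_ind => [|c p r e e'|i p e]; first by rewrite f1.
- by rewrite lin /= e e'.
- by rewrite fT /= e.
Qed.

Lemma gendvn_var f i p : gendvn f (T i * p) = f i * p + T i * gendvn f p.
Proof.
rewrite -{2}(dvn_pair1 f p) /gendvn /dvn_pair.
by case: (oprecP (1, 0) (dvn_step_linear f) (dvn_step_comm f)) => /= _ _ ->.
Qed.

Definition form_step i (g : A -> K^o) : A -> K^o :=
  fun r => (2 * od i)%N%:R^-1 * g (d i r).

Lemma form_step_linear i : linear (form_step i : (A -> K^o) -> (A -> K^o)).
Proof.
move=> c f g; apply: (@boolp.funext A K) => r; rewrite /form_step !fctE.
by rewrite mulrDr mulrCA.
Qed.

Lemma form_step_comm i j (g : A -> K^o) :
  form_step i (form_step j g) = form_step j (form_step i g).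
Proof.
apply: (@boolp.funext A K) => r; rewrite /form_step.
by rewrite dC mulrCA.
Qed.

Definition genform p r : K :=
  oprec (e0 : A -> K^o) form_step_linear form_step_comm p r.

Lemma genform_linl r : scalar (genform^~ r).
Proof.
move=> c p p'; rewrite /genform.
by case: (oprecP (e0 : A -> K^o) form_step_linear form_step_comm) => /= -> _ _.
Qed.

Lemma genform1 p : genform 1 p = e0 p.
Proof.
rewrite /genform.
by case: (oprecP (e0 : A -> K^o) form_step_linear form_step_comm) => /= _ -> _.
Qed.

Lemma genform_var i p r :
  genform (T i * p) r = (2 * od i)%N%:R^-1 * genform p (d i r).
Proof.
rewrite /genform.
by case: (oprecP (e0 : A -> K^o) form_step_linear form_step_comm) => /= _ _ ->.
Qed.

Lemma genform_linr p : scalar (genform p).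
Proof.
move: p; apply: A_ind => [|c p p' IH IH'|i p IH] a r r'.
- by rewrite !genform1 raddfD /= e0Z.
- by rewrite !genform_linl IH IH'; ring.
- by rewrite !genform_var linearP IH; ring.
Qed.

Lemma genform0r p : genform p 0 = 0.
Proof. by have := genform_linr p (-1) 0 0; rewrite scaler0 addr0 mulN1r addNr. Qed.
Lemma genform0l p : genform 0 p = 0.
Proof. by have := genform_linl p (-1) 0 0; rewrite scaler0 addr0 mulN1r addNr. Qed.

Lemma genform_varr i p r :
  genform p (T i * r) = (2 * od i)%N%:R^-1 * genform (d i p) r.
Proof.
move: p r; apply: A_ind => [|c p p' IH IH'|j p IH] r.
- by rewrite genform1 rmorphM /= e0T mul0r d1 genform0l mulr0.
- by rewrite linearP !genform_linl IH IH'; ring.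
rewrite genform_var !d_varM genform_linr genform_linl IH genform_var !mulrDr.
have [->|ij] := eqVneq j i; first by congr (_ + _); rewrite mulrCA.
by rewrite !mul0r !mulr0 !add0r mulrCA.
Qed.

Lemma genformC p r : genform p r = genform r p.
Proof.
move: p r; apply: A_ind => [|c p p' IH IH'|i p IH] r.
- rewrite genform1; move: r; apply: A_ind => [|c r r' e e'|i r e].
  + by rewrite genform1.
  + by rewrite genform_linl raddfD /= e0Z e e'.
  by rewrite genform_var d1 genform0r mulr0 rmorphM /= e0T mul0r.
- by rewrite genform_linl genform_linr IH IH'.
by rewrite genform_var genform_varr IH.
Qed.

Definition fock : bosonFock K :=
  @BosonFock K A charK T d e0 genq genvop genform gendvn
    e0Z e0T d1 d_varM' A_ind A_eq0 e0_genq d_genq genvop1 genvop_var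
    genform_linr genformC genform1 genform_var gendvn1 gendvn_var.

End Build.

(** * Derivations, constant term and induction on the monoid algebra *)

Section TPoly.
Variable K : fieldType.
Implicit Types (p q : tpoly K) (i j : nat) (m : {cmonom nat}).

Local Notation "1" := (@mone _) : monom_scope.
Local Notation T i := (<< ucm i >> : tpoly K).

Definition eps p : K := p@_1%M.

Lemma mulcm_divcm m i : (0 < m i)%N -> mulcm (divcm m (ucm i)) (ucm i) = m.
Proof.
move=> mi; apply/eqP/cmP => j; rewrite mulcmE divcmE ucmE.
by case: eqP => [<-|_] /=; rewrite ?subnK // subn0 addn0.
Qed.

Lemma divcm_mulcm m i : divcm (mulcm m (ucm i)) (ucm i) = m.
Proof. by apply/eqP/cmP => j; rewrite divcmE mulcmE addnK. Qed.

Lemma mcoeff_pderiv i p m :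
  (pderiv i p)@_m = p@_(mulcm m (ucm i)) *+ (m i).+1.
Proof.
rewrite /pderiv raddf_sum /=.
under eq_bigr do rewrite mcoeffU.
have [mp|mp] := boolP (mulcm m (ucm i) \in msupp p).
  rewrite (big_fsetD1 _ mp) /= divcm_mulcm eqxx mulr1n mulcmE ucmE eqxx addn1.
  rewrite big1_fset ?addr0 // => m' /fsetD1P[m'm _] _.
  have [m'i|] := posnP (m' i); first by rewrite m'i mulr0n mul0rn.
  move=> m'i; case: eqP => // e; case/eqP: m'm.
  by rewrite -e mulcm_divcm.
rewrite (mcoeff_outdom mp) mul0rn big1_fset // => m' m'p _.
have [m'i|m'i] := posnP (m' i); first by rewrite m'i mulr0n mul0rn.
by case: eqP => // e; case/negP: mp; rewrite -e mulcm_divcm.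
Qed.

Lemma mcoeffP c p q m : (c *: p + q)@_m = c * p@_m + q@_m.
Proof. by rewrite mcoeffD mcoeffZ. Qed.

Lemma pderiv_is_linear i : linear (@pderiv K i).
Proof.
move=> c p q; apply/malgP => m.
rewrite [LHS]mcoeff_pderiv [X in X *+ _]mcoeffP [RHS]mcoeffP.
rewrite [X in _ = _ * X + _]mcoeff_pderiv [X in _ = _ + X]mcoeff_pderiv.
by rewrite mulrnDl mulrnAr.
Qed.
HB.instance Definition _ i :=
  GRing.isLinear.Build K (tpoly K) (tpoly K) *:%R (@pderiv K i)
    (pderiv_is_linear i).

Lemma mcoeff_mulTE i p m :
  (T i * p)@_m = \sum_(m' <- msupp p) p@_m' *+ (mulcm m' (ucm i) == m).
Proof.
have -> : T i * p = \sum_(m' <- msupp p) << p@_m' * 1 *g mmul m' (ucm i) >>.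
  by rewrite mulrC malgM_def fgmulgU.
rewrite raddf_sum /=; apply: eq_bigr => m' _.
by rewrite mcoeffU mulr1.
Qed.

Lemma mcoeff_mulT i p m : (T i * p)@_(mulcm m (ucm i)) = p@_m.
Proof.
rewrite mcoeff_mulTE.
have inj m' : (mulcm m' (ucm i) == mulcm m (ucm i)) = (m' == m).
  apply/eqP/eqP => [e|-> //].
  by rewrite -[m'](divcm_mulcm m' i) e divcm_mulcm.
under eq_bigr do rewrite inj.
have [mp|mp] := boolP (m \in msupp p).
  rewrite (big_fsetD1 _ mp) /= eqxx big1_fset ?addr0 // => m' /fsetD1P[/negPf-> _] _.
  by rewrite mulr0n.
rewrite (mcoeff_outdom mp) big1_fset // => m' m'p _.
by case: eqP => // e; case/negP: mp; rewrite -e.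
Qed.

Lemma mcoeff_mulT0 i p m : m i = 0%N -> (T i * p)@_m = 0.
Proof.
move=> mi; rewrite mcoeff_mulTE big1 // => m' _.
case: eqP => // e; move: mi; rewrite -e.
by rewrite mulcmE ucmE eqxx addn1.
Qed.

Lemma pderiv_mulT i j p :
  pderiv i (T j * p) = (i == j)%:R *: p + T j * pderiv i p.
Proof.
apply/malgP => m; rewrite [LHS]mcoeff_pderiv [RHS]mcoeffP.
have [<-|ij] := eqVneq i j.
  rewrite [X in _ = X + _]mul1r [X in X *+ _]mcoeff_mulT mulrS; congr (_ + _).
  have [mi|mi] := posnP (m i).
    rewrite mi; apply/esym; exact: mcoeff_mulT0.
  rewrite -(mulcm_divcm mi) [RHS]mcoeff_mulT [RHS]mcoeff_pderiv mulcm_divcm //.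
  by rewrite divcmE ucmE eqxx subn1 prednK.
rewrite [X in _ = X + _]mul0r [RHS]add0r.
have [mj|mj] := posnP (m j).
  have mij : mulcm m (ucm i) j = 0%N by rewrite mulcmE mj ucmE (negPf ij).
  by rewrite [X in X *+ _](@mcoeff_mulT0 _ _ _ mij) [RHS](@mcoeff_mulT0 _ _ _ mj) mul0rn.
rewrite -(mulcm_divcm mj) -mulcmA [mulcm (ucm j) _]mulcmC mulcmA.
rewrite [X in X *+ _]mcoeff_mulT [RHS]mcoeff_mulT [RHS]mcoeff_pderiv.
by rewrite mulcm_divcm // divcmE ucmE eq_sym (negPf ij) subn0.
Qed.

Lemma pderiv1 i : pderiv i 1 = 0 :> tpoly K.
Proof.
apply/malgP => m; rewrite mcoeff_pderiv mcoeff0 mcoeff1.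
case: eqP => [/(congr1 (fun m' : {cmonom nat} => m' i))|]; last by rewrite mul0rn.
by rewrite cm1 mulcmE ucmE eqxx addn1.
Qed.

Lemma eps_is_linear : scalar eps.
Proof. by move=> c p q; rewrite /eps mcoeffD mcoeffZ. Qed.
HB.instance Definition _ :=
  GRing.isLinear.Build K (tpoly K) K *%R eps eps_is_linear.

Lemma eps_is_multiplicative : multiplicative eps.
Proof. exact: mcoeff1g_is_multiplicative. Qed.
HB.instance Definition _ :=
  GRing.isMultiplicative.Build (tpoly K) K eps eps_is_multiplicative.

Lemma eps_T i : eps (T i) = 0.
Proof. by rewrite -(mulr1 (T i)) /eps mcoeff_mulT0 ?cm1. Qed.

Lemma cmonom_ind (P : {cmonom nat} -> Prop) :
  P 1%M -> (forall m i, P m -> P (mulcm m (ucm i))) -> forall m, P m.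
Proof.
move=> P1 PM m; move e : (mdeg m) => n.
elim: n m e => [|n IH] m e; first by rewrite (mdeg_eq0I e).
have [i mi] : exists i, (0 < m i)%N.
  case: (fset_0Vmem (finsupp m)) => [m0|[i im]].
    by move: e; rewrite mdegE m0 big_seq_fset0.
  by exists i; rewrite lt0n cmE_neq0.
rewrite -(mulcm_divcm mi); apply/PM/IH.
apply/eqP; rewrite -eqSS -e -{2}(mulcm_divcm mi).
by rewrite -[mulcm _ _]/(mmul _ _) mdegM mdegU addn1.
Qed.

Lemma tpoly_ind (P : tpoly K -> Prop) :
    P 1 -> (forall c p q, P p -> P q -> P (c *: p + q)) ->
    (forall i p, P p -> P (T i * p)) ->
  forall p, P p.
Proof.
move=> P1 PD PM p.
have P0 : P 0 by have := PD (-1) 1 1 P1 P1; rewrite scaleN1r addNr.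
rewrite (monalgE p); elim: (enum_fset _) => [|m s IH]; first by rewrite big_nil.
rewrite big_cons.
have e : << p@_m *g m >> = p@_m *: << m >> :> tpoly K.
  by apply/malgP => m'; rewrite [LHS]mcoeffU [RHS]mcoeffZ [X in _ * X]mcoeffU mulr_natr.
rewrite [X in P (X + _)]e; apply: PD; last exact: IH.
move: m {e}; apply: cmonom_ind => [|m' i Pm']; first exact: P1.
have e' : << mulcm m' (ucm i) >> = T i * << m' >> :> tpoly K.
  by rewrite malgM_def fgmulUU mulr1 mulcmC.
by rewrite e'; apply: PM.
Qed.

Hypothesis charK : [pchar K] =i pred0.

(** Iterated derivation brings any coefficient to the constant term, multiplied by a positive
    integer that is nonzero in characteristic 0. *)
Lemma tpoly_eq0 (P : tpoly K -> Prop) :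
    (forall p, P p -> eps p = 0) -> (forall i p, P p -> P (pderiv i p)) ->
  forall p, P p -> p = 0.
Proof.
move=> P0 PD p Pp; apply/malgP => m; rewrite mcoeff0.
elim/cmonom_ind: m p Pp => [p /P0 //|m i IH p Pp].
have := IH _ (PD i p Pp); rewrite mcoeff_pderiv -mulr_natr => /eqP.
by rewrite mulf_eq0 ((pcharf0P K).1 charK) orbF => /eqP.
Qed.

End TPoly.

(** * The universal property of the polynomial ring *)

Section Rec.
Variables (K : fieldType) (V : lmodType K) (x : nat -> V -> V) (v : V).
Hypothesis x_linear : forall i, linear (x i).
Hypothesis xC : forall i j u, x i (x j u) = x j (x i u).

Local Notation "1" := (@mone _) : monom_scope.
Local Notation T i := (<< ucm i >> : tpoly K).
Implicit Types (m : {cmonom nat}) (i : nat).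

Definition mon_bound m : nat := \max_(i <- finsupp m) i.+1.

Lemma mon_boundP m i : (mon_bound m <= i)%N -> m i = 0%N.
Proof.
move=> mi; apply/eqP; rewrite cmE_eq0; apply/negP => im.
have := @leq_bigmax_seq _ _ xpredT (fun i : nat => i.+1) i im isT.
by rewrite -/(mon_bound m) => /(leq_trans) /(_ mi); rewrite ltnn.
Qed.

Definition act_seq m (s : seq nat) : V := foldr (fun i => iter (m i) (x i)) v s.

Definition act m : V := act_seq m (iota 0 (mon_bound m)).

Lemma act_seqE m N : (mon_bound m <= N)%N -> act_seq m (iota 0 N) = act m.
Proof.
move=> mN; rewrite -(subnKC mN) iotaD /act_seq foldr_cat; congr foldr.
have : forall i, i \in iota (0 + mon_bound m) (N - mon_bound m) -> m i = 0%N.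
  by move=> i; rewrite mem_iota => /andP[/mon_boundP].
elim: (iota _ _) => //= i s IH m0; rewrite m0 ?mem_head //=.
by apply: IH => j js; apply: m0; rewrite inE js orbT.
Qed.

Lemma iter_xC i j n u : iter n (x i) (x j u) = x j (iter n (x i) u).
Proof. by elim: n => //= n ->. Qed.

Lemma act_seq_mul m i s : uniq s -> i \in s ->
  act_seq (mulcm m (ucm i)) s = x i (act_seq m s).
Proof.
elim: s => //= j s IH /andP[js us]; rewrite inE mulcmE ucmE.
have [-> _|ij /= /(IH us) ->] := eqVneq i j; last by rewrite addn0 iter_xC.
rewrite addn1 iterS; congr (x j (iter _ _ _)).
elim: s js {IH us} => //= k s IH; rewrite inE negb_or => /andP[jk js].
by rewrite mulcmE ucmE (negPf jk) addn0 IH.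
Qed.

Lemma act_mul m i : act (mulcm m (ucm i)) = x i (act m).
Proof.
pose N := maxn (mon_bound (mulcm m (ucm i))) (maxn (mon_bound m) i.+1).
have [h1 h2 h3] : [/\ mon_bound (mulcm m (ucm i)) <= N, mon_bound m <= N & i < N]%N.
  by rewrite /N; split; lia.
rewrite -(act_seqE h1) -(act_seqE h2); apply: act_seq_mul; first exact: iota_uniq.
by rewrite mem_iota.
Qed.

Lemma act1 : act 1%M = v.
Proof.
rewrite /act /act_seq; elim: (iota _ _) => //= i s ->.
by rewrite cm1.
Qed.

Definition tpoly_rec (p : tpoly K) : V := \sum_(m <- msupp p) p@_m *: act m.

Lemma tpoly_recE (D : {fset {cmonom nat}}) p : (msupp p `<=` D)%fset ->
  tpoly_rec p = \sum_(m <- D) p@_m *: act m.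
Proof.
move=> pD; rewrite /tpoly_rec; apply: big_fset_incl => // m _ mp.
by rewrite mcoeff_outdom // scale0r.
Qed.

Lemma tpoly_rec_linear : linear tpoly_rec.
Proof.
move=> c p r.
have h : (msupp (c *: p + r) `<=` msupp p `|` msupp r)%fset.
  apply: fsubset_trans (msuppD_le _ _) _.
  by apply: fsetSU; apply: msuppZ_le.
rewrite (tpoly_recE h) (tpoly_recE (fsubsetUl _ (msupp r))).
rewrite (tpoly_recE (fsubsetUr (msupp p) _)) scaler_sumr -big_split.
apply: eq_bigr => m _; rewrite /= scalerA -scalerDl; congr (_ *: _).
exact: mcoeffP.
Qed.
HB.instance Definition _ :=
  GRing.isLinear.Build K (tpoly K) V *:%R tpoly_rec tpoly_rec_linear.

Lemma tpoly_rec_monom c m : tpoly_rec << c *g m >> = c *: act m.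
Proof.
rewrite (tpoly_recE msuppU_le) big_seq_fset1; congr (_ *: _).
exact: mcoeffUU.
Qed.

Lemma tpoly_rec1 : tpoly_rec 1 = v.
Proof. by rewrite [LHS](tpoly_rec_monom 1 1%M) scale1r act1. Qed.

Lemma tpoly_recM i p : tpoly_rec (T i * p) = x i (tpoly_rec p).
Proof.
have xS (I : Type) (s : seq I) (c : I -> K) (F : I -> V) :
    x i (\sum_(j <- s) c j *: F j) = \sum_(j <- s) c j *: x i (F j).
  elim: s => [|j s IH]; last by rewrite !big_cons x_linear IH.
  rewrite !big_nil; have := x_linear i (-1) 0 0.
  by rewrite scaleN1r oppr0 addr0 scaleN1r addNr.
rewrite /(tpoly_rec p) xS.
have -> : T i * p = \sum_(m' <- msupp p) << p@_m' * 1 *g mmul m' (ucm i) >>.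
  by rewrite mulrC malgM_def fgmulgU.
rewrite raddf_sum; apply: eq_bigr => m _ /=.
rewrite [LHS]tpoly_rec_monom mulr1; congr (_ *: _); exact: act_mul.
Qed.

End Rec.

(** * Transfer to the given Q-polynomials, inner product and operators *)

Section Instance.
Variables (K : fieldType) (charK : [pchar K] =i pred0).

Lemma tpoly_rec_sig (V : lmodType K) (x : nat -> V -> V) (v : V) :
  (forall i, linear (x i)) -> (forall i j u, x i (x j u) = x j (x i u)) ->
  {f : tpoly K -> V | [/\ linear f, f 1 = v
     & forall i p, f (<< ucm i >> * p) = x i (f p)]}.
Proof.
move=> xl xC; exists (tpoly_rec x v); split.
- exact: tpoly_rec_linear.
- exact: tpoly_rec1.
- exact: tpoly_recM.
Qed.

Lemma eps_scale (c : K) (p : tpoly K) : eps (c *: p) = c * eps p.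
Proof. exact: linearZ. Qed.

Definition tfock : bosonFock K :=
  @fock K (tpoly K) charK (fun i => << ucm i >>) (fun i => @pderiv K i)
    (@eps K) eps_scale (@eps_T K) (@pderiv1 K) (@pderiv_mulT K)
    (@tpoly_ind K) (tpoly_eq0 charK) tpoly_rec_sig.

(** Conversion suffices: the generic definitions repeat the original ones, and [qf] of [tfock]
    unfolds to [genq], hence to [qk]. *)
Lemma schurQE la : schurQ K la = genQ (@qf K tfock) la.
Proof. by []. Qed.

Local Notation form := (@form K tfock).

Lemma form_isQform : isQform form.
Proof.
split; [exact: (@form_linr K tfock) | exact: (@form_linl K tfock) |].
move=> la mu sla smu; rewrite !schurQE !genQ_ge0 ?strict_ge0 //.
exact: form_vops.
Qed.

(** [form] shows that a form as required exists, so the one selected by [xget] has the defining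
    property, and [form_unique] identifies the two. *)
Lemma QformE p r : Qform p r = form p r.
Proof.
have [Ql Qr Qs] : isQform (@Qform K) by apply: (xgetI _ form_isQform).
apply: form_unique => // la mu sla smu.
by rewrite -!(genQ_ge0 tfock) ?strict_ge0 // -!schurQE; apply: Qs.
Qed.

(** The map [g] witnesses that an adjoint exists, and nondegeneracy forces the one selected by
    [xget] to equal it. *)
Lemma adjointE (f g : tpoly K -> tpoly K) :
  (forall p r, form (g p) r = form p (f r)) -> adjoint f =1 g.
Proof.
move=> fg p; apply/eqP; rewrite -subr_eq0; apply/eqP.
apply: (@form_nondeg K tfock) => r; rewrite formBl fg -!QformE.
have adj : [set g | forall p1 p2, Qform (g p1) p2 = Qform p1 (f p2)]%classic g.
  by move=> p1 p2; rewrite !QformE.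
by rewrite (xgetI (fun=> 0) adj) subrr.
Qed.

Lemma fsbig_odd (F : nat -> tpoly K) (N : nat) :
  (forall i, (N <= i)%N -> F (od i) = 0) ->
  \sum_(k \in [set k : nat | odd k]%classic) F k = \sum_(i < N) F (od i).
Proof.
move=> F0; rewrite (@fsbigE _ _ _ _ _ [seq od i | i <- iota 0 N]).
- rewrite big_map (eq_bigl xpredT) => [|i]; first by rewrite -{1}[N]subn0 big_mkord.
  by rewrite mem_set //= odd_double.
- by rewrite map_inj_uniq ?iota_uniq // => i j /= e; lia.
- by move=> k /= /mapP[i _ ->]; rewrite /= odd_double.
move=> k /= ok kN; have kE : k = od k./2 by have := odd_double_half k; rewrite ok; lia.
rewrite kE F0 // leqNgt; apply/negP => k2; case/negP: kN.
by apply/mapP; exists k./2; rewrite // mem_iota.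
Qed.

Lemma tvar_od i : tvar K (od i) = << ucm i >>.
Proof. by rewrite /tvar /= uphalf_double. Qed.

Lemma dt_od i p : dt (od i) p = pderiv i p :> tpoly K.
Proof. by rewrite /dt /= odd_double /= uphalf_double. Qed.

Lemma raise1E p :
  \sum_(k \in [set k : nat | odd k]%classic) k%:R * tvar K k * dt (k - 2)%N p =
  raise tfock 1 p.
Proof.
have [N0 h] := @dvn_sum K tfock p.
have dN i : (N0 <= i)%N -> pderiv i p = 0 by case/h.
rewrite (@fsbig_odd _ N0.+1) => [|[|i] // iN]; last first.
  have -> : (od i.+1 - 2 = od i)%N by lia.
  rewrite dt_od [X in _ * X]dN //; exact: mulr0.
(* The term [k = 1] contains [dt (1 - 2)], that is [dt 0], which is 0. *)
rewrite [RHS](h N0 (leqnn N0)).2 big_ord_recl [X in X + _]mulr0 add0r.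
apply: eq_bigr => i _; rewrite tvar_od.
have -> : (od (lift ord0 i) - 2 = od i)%N by rewrite lift0; lia.
by rewrite dt_od lift0 addn1.
Qed.

Lemma lower2E p :
  \sum_(k \in [set k : nat | odd k]%classic) k%:R * tvar K k * dt (k + 4)%N p =
  lower tfock 2 p.
Proof.
have [N0 h] := @dvn_sum K tfock p.
have dN i : (N0 <= i)%N -> pderiv i p = 0 by case/h.
have od4 i : (od i + 4 = od i.+2)%N by lia.
rewrite (@fsbig_odd _ N0) => [|i iN]; last first.
  have iN2 : (N0 <= i.+2)%N by lia.
  by rewrite od4 dt_od [X in _ * X](dN _ iN2); exact: mulr0.
have N2 : (N0 <= N0.+2)%N by lia.
(* [lower 2] kills [t_1] and [t_3]; dropping these two terms aligns the indices. *)
rewrite [RHS](h _ N2).2 !big_ord_recl [X in X + _]mul0r add0r [X in X + _]mul0r add0r.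
apply: eq_bigr => i _; rewrite tvar_od od4 dt_od !lift0 subSS subSS subn0.
reflexivity.
Qed.

Lemma Lm1E h (p : tpoly K) : Lm1 h p =
  4%:R^-1 *: (<< ucm 0%N >> * << ucm 0%N >> * p) + 2%:R^-1 *: raise tfock 1 p
  - (2%:R * h)^-1 *: pderiv 0 p.
Proof. by rewrite /Lm1 raise1E. Qed.

Lemma L2E h (p : tpoly K) : L2 h p =
  2%:R^-1 *: lower tfock 2 p + 2%:R^-1 *: pderiv 0 (pderiv 1 p)
  - (2%:R * h)^-1 *: pderiv 3 p.
Proof. by rewrite /L2 lower2E. Qed.

Lemma adjoint_Lm1 h : adjoint (Lm1 h) =1 @Lm1adj K tfock h.
Proof. by apply: adjointE => p r; rewrite Lm1E; apply: form_Lm1adj. Qed.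

Lemma adjoint_L2 h : adjoint (L2 h) =1 @L2adj K tfock h.
Proof. by apply: adjointE => p r; rewrite L2E; apply: form_L2adj. Qed.

Local Notation Q := (schurQ K).

Lemma adjoint_Lm1_schurQ h la : strict la ->
  adjoint (Lm1 h) (Q la) =
      - (4%:R^-1 *: \sum_(i < size la) \sum_(j < size la | j != i)
                      Q (addp (addp la i (- 1)) j (- 1)))
      + \sum_(i < size la) ((2 * la`_i - 3)%:~R / 4%:R) *: Q (addp la i (- 2))
      - h^-1 *: (\sum_(i < size la) Q (addp la i 1) + 2%:R^-1 *: Q (la ++ [:: 1])).
Proof.
move=> sla; exact: (etrans (adjoint_Lm1 h (Q la)) (@Lm1adj_genQ K tfock h la sla)).
Qed.

Lemma adjoint_L2_schurQ h la : strict la ->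
  adjoint (L2 h) (Q la) =
      \sum_(i < size la) \sum_(j < size la | j != i) Q (addp (addp la i 3) j 1)
      + \sum_(i < size la) ((la`_i + 4)%:~R / 2%:R) *: Q (addp la i 4)
      + 2%:R^-1 *: (\sum_(i < size la) Q (addp la i 3 ++ [:: 1]))
      + 2%:R^-1 *: (\sum_(i < size la) Q (addp la i 1 ++ [:: 3]))
      - 2%:R^-1 *: (\sum_(i < size la) Q (addp la i 1 ++ [:: 2; 1]))
      + Q (la ++ [:: 4])
      - 2%:R^-1 *: Q (la ++ [:: 3; 1])
      - h^-1 *: (\sum_(i < size la) Q (addp la i 7)
                    + 2%:R^-1 *: \sum_(r < 4) (-1) ^+ r *: Q (la ++ [:: 7 - r%:Z; r%:Z])).
Proof.
move=> sla; exact: (etrans (adjoint_L2 h (Q la)) (@L2adj_genQ K tfock h la sla)).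
Qed.

End Instance.

Lemma Qh_char0 : [pchar Qh] =i pred0.
Proof.
apply/pcharf0P => n; rewrite -(rmorph_nat (@tofrac {poly rat})) tofrac_eq0.
by rewrite -polyC_natr polyC_eq0 Num.Theory.pnatr_eq0.
Qed.

Unset Implicit Arguments.

Theorem proposition4p4 (la : seq int) (hla : strict la) :
  let l := size la in
  let Q := @schurQ Qh in
  adjoint (Lm1 hbar) (Q la) =
      - (4%:R^-1 *: \sum_(i < l) \sum_(j < l | j != i)
                      Q (addp (addp la i (- 1)) j (- 1)))
      + \sum_(i < l) ((2 * la`_i - 3)%:~R / 4%:R) *: Q (addp la i (- 2))
      - hbar^-1 *: (\sum_(i < l) Q (addp la i 1) + 2%:R^-1 *: Q (la ++ [:: 1]))
  /\
  adjoint (L2 hbar) (Q la) =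
      \sum_(i < l) \sum_(j < l | j != i) Q (addp (addp la i 3) j 1)
      + \sum_(i < l) ((la`_i + 4)%:~R / 2%:R) *: Q (addp la i 4)
      + 2%:R^-1 *: (\sum_(i < l) Q (addp la i 3 ++ [:: 1]))
      + 2%:R^-1 *: (\sum_(i < l) Q (addp la i 1 ++ [:: 3]))
      - 2%:R^-1 *: (\sum_(i < l) Q (addp la i 1 ++ [:: 2; 1]))
      + Q (la ++ [:: 4])
      - 2%:R^-1 *: Q (la ++ [:: 3; 1])
      - hbar^-1 *: (\sum_(i < l) Q (addp la i 7)
                    + 2%:R^-1 *: \sum_(r < 4) (-1) ^+ r *: Q (la ++ [:: 7 - r%:Z; r%:Z])).
Proof.
by split; [apply: (adjoint_Lm1_schurQ Qh_char0) | apply: (adjoint_L2_schurQ Qh_char0)].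
Qed.
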